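(* Let $\alpha\in(0,1)$ and let $V\in L^\infty(\mathbb R)$ be a compactly supported real-valued potential such that - $V=x_+^\alpha$ on an interval $(-\infty,x_0)$ with $x_0\in(0,1)$; - $V$ is $C^\infty$ away from $x=0$, and $\sup V<1$. Let $P=(hD_x)^2+V=-h^2\frac{d^2}{dx^2}+V$, and for $h>0$ let $u$ be the unique solution of $(P-1)u=0$ on $\mathbb R$ of the form $$u(x)=\begin{cases}e^{ix/h}+Re^{-ix/h}, & x\le0,\\ Te^{ix/h}, & x\gg1,\end{cases}$$ where $R=R(h),T=T(h)\in\mathbb C$. Then $$R\sim 2^{-\alpha-2}e^{i\alpha\pi/2}\,\Gamma(\alpha+1)\,h^\alpha\qquad\text{as }h\to0.$$
   Context: $x_+=\max(x,0)$, $D_x=-i\,d/dx$, $\Gamma$ is the Gamma function. $R\sim c\,h^\alpha$ means $R/(c\,h^\alpha)\to1$ as $h\to0^+$. *)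

(* Defs.v *)
From Stdlib Require Export Reals.
From Coquelicot Require Export Coquelicot.

Open Scope R_scope.

(* The case distinction is needed because [Rpower 0 alpha = 1]. *)
Definition pos_part_pow (alpha x : R) : R :=
  if Rlt_dec 0 x then Rpower x alpha else 0.

(* Euler's integral, for s > 0.  The endpoint 0 is taken as a limit: the
   integrand is singular there when s < 1. *)
Definition Gamma (s : R) : R :=
  RInt_gen (fun t : R => Rpower t (s - 1) * exp (- t))
           (at_right 0) (Rbar_locally p_infty).

(* e^{i theta} for real theta *)
Definition expi (theta : R) : C := (cos theta, sin theta).

Definition bounded_fun (V : R -> R) : Prop :=
  exists M : R, forall x : R, Rabs (V x) <= M.

Definition compactly_supported (V : R -> R) : Prop :=
  exists M : R, forall x : R, M < Rabs x -> V x = 0.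

Definition smooth_away_from_0 (V : R -> R) : Prop :=
  forall (n : nat) (x : R), x <> 0 -> ex_derive_n V n x.

Definition sup_fun (V : R -> R) : Rbar :=
  Lub_Rbar (fun y : R => exists x : R, y = V x).

(* (P - E) u = 0 with P = - h^2 d^2/dx^2 + V, classically: for a continuous
   potential, distributional solutions are twice differentiable.  The
   derivatives are with respect to the real variable x. *)
Definition schrodinger_solution (V : R -> R) (h E : R) (u : R -> C) : Prop :=
  exists u1 u2 : R -> C,
    (forall x : R, @is_derive R_AbsRing C_R_NormedModule u x (u1 x)) /\
    (forall x : R, @is_derive R_AbsRing C_R_NormedModule u1 x (u2 x)) /\
    (forall x : R,
       ((- RtoC (h ^ 2) * u2 x + RtoC (V x) * u x) - RtoC E * u x)%C = RtoC 0).

Definition scattering_solution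
    (V : R -> R) (h : R) (u : R -> C) (r t : C) : Prop :=
  schrodinger_solution V h 1 u /\
  (forall x : R, x <= 0 -> u x = (expi (x / h) + r * expi (- x / h))%C) /\
  (exists M : R, forall x : R, M < x -> u x = (t * expi (x / h))%C).

(* f ~ g as h -> 0+ *)
Definition equiv_at_0plus (f g : R -> C) : Prop :=
  filterlim (fun h : R => (f h / g h)%C) (at_right 0) (locally (RtoC 1)).

(* Main.v *)
(** Idea.  On x > 0 write p = (1 - V)^{1/2}, phi(x) = int_0^x p and split u into its two WKB modes,
    u = p^{-1/2} (a e^{i phi/h} + b e^{-i phi/h}), h u' = i p^{1/2} (a e^{i phi/h} - b e^{-i phi/h}).
    With g = p'/(2p) the amplitudes satisfy exactly a' = g e^{-2i phi/h} b, b' = g e^{2i phi/h} a, and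
    a(0) = 1, b(0) = R, b = 0 to the right of supp V.  Since g = O(x^{alpha - 1}) is integrable at 0,
    a and b are bounded (|R| <= 1 by conservation of the Wronskian), and one integration by parts
    against the phase gives b(x) = O(h x^{alpha - 1}).  Hence at x = L h the error b(L h) is
    O(L^{alpha - 1} h^alpha), while on [0, L h] one may replace a by 1, phi by x and g by
    -(alpha/4) x^{alpha - 1} up to o(h^alpha).  So R / h^alpha tends to
    (alpha/4) int_0^oo y^{alpha - 1} e^{2iy} dy, which is a rotated Euler integral; the substitution
    s = y^alpha removes its singularity at 0. *)
Require Import Defs.
From Stdlib Require Import Reals Lra Lia Psatz Classical FunctionalExtensionality.
From Coquelicot Require Import Coquelicot.
Open Scope R_scope.

(** * Differentiation of real and complex functions *)

(** The potential is only Hoelder continuous at 0, so the amplitude equations hold for x > 0 only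
    and their coefficients blow up at 0. No improper integral of them is formed: increments are
    compared with an explicit primitive, a power continuous at 0, by a mean value inequality that
    uses derivatives in the open interval only. The bound on b far from 0 is useless at 0, and the
    comparison with the model near 0 is useless at a fixed x > 0. They are matched at x = L eta with
    eta = h / 2. The far error is small relative to eta^alpha once L is large; the near error is
    eta^{2 alpha} times a growing function of L. So L is fixed first and h tends to 0 afterwards.
    The choice of eta turns the phases into e^{+- i phi / eta} and splits the constant: 2^{-alpha}
    comes from eta^alpha and 2^{-2} from the factor 1/4 in g. The factor alpha of g is absorbed by
    ds = alpha y^{alpha - 1} dy, which is why Gamma(alpha + 1) appears directly. Existence and
    uniqueness of u are part of the statement; the solution is built from its outgoing side, and the
    Wronskian shows that it can be normalised. *)

Lemma derive_eq (f : R -> R) (x a b : R) : is_derive f x a -> a = b -> is_derive f x b.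
Proof. now intros H <-. Qed.

Lemma derive_plus (f g : R -> R) (x a b : R) :
  is_derive f x a -> is_derive g x b -> is_derive (fun y => f y + g y) x (a + b).
Proof. intros; now apply (is_derive_plus f g). Qed.

Lemma derive_minus (f g : R -> R) (x a b : R) :
  is_derive f x a -> is_derive g x b -> is_derive (fun y => f y - g y) x (a - b).
Proof. intros; now apply (is_derive_minus f g). Qed.

Lemma derive_mult (f g : R -> R) (x a b : R) :
  is_derive f x a -> is_derive g x b -> is_derive (fun y => f y * g y) x (a * g x + f x * b).
Proof. intros; apply (is_derive_mult f g); auto; intros; apply Rmult_comm. Qed.

Lemma derive_scale (f : R -> R) (c x a : R) : is_derive f x a -> is_derive (fun y => c * f y) x (c * a).
Proof. intros; now apply (is_derive_scal f x c a). Qed.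

Lemma derive_opp (f : R -> R) (x a : R) : is_derive f x a -> is_derive (fun y => - f y) x (- a).
Proof. intros; now apply (is_derive_opp f). Qed.

Lemma derive_comp (f g : R -> R) (x a b : R) :
  is_derive f (g x) a -> is_derive g x b -> is_derive (fun y => f (g y)) x (b * a).
Proof. intros; now apply (is_derive_comp f g). Qed.

Lemma derive_const (c x : R) : is_derive (fun _ => c) x 0.
Proof. apply (is_derive_const (K := R_AbsRing) (V := R_NormedModule) c x). Qed.

Lemma derive_id (x : R) : is_derive (fun y => y) x 1.
Proof. apply (is_derive_id (K := R_AbsRing) x). Qed.

Lemma derive_exp (x : R) : is_derive exp x (exp x).
Proof. apply is_derive_Reals, derivable_pt_lim_exp. Qed.

Lemma derive_cos (x : R) : is_derive cos x (- sin x).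
Proof. apply is_derive_Reals, derivable_pt_lim_cos. Qed.

Lemma derive_sin (x : R) : is_derive sin x (cos x).
Proof. apply is_derive_Reals, derivable_pt_lim_sin. Qed.

Lemma derive_Rpower (x y : R) : 0 < x -> is_derive (fun z => Rpower z y) x (y * Rpower x (y - 1)).
Proof. intros; now apply is_derive_Reals, derivable_pt_lim_power. Qed.

Lemma derive_continuous (f : R -> R) (x l : R) : is_derive f x l -> continuous f x.
Proof. intros H; apply (ex_derive_continuous f). now exists l. Qed.

Lemma continuous_eps (f : R -> R) (x : R) :
  (forall eps, 0 < eps -> exists d, 0 < d /\ forall y, Rabs (y - x) < d -> Rabs (f y - f x) < eps) ->
  continuous f x.
Proof.
intros H. apply filterlim_locally. intros eps.
destruct (H eps (cond_pos eps)) as [d [Hd Hy]]. exists (mkposreal d Hd). intros y Hb.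
apply Hy, Hb.
Qed.

Lemma continuity_pt_continuous (f : R -> R) x : continuity_pt f x <-> continuous f x.
Proof. apply continuity_pt_filterlim. Qed.

Lemma continuous_Ropp (f : R -> R) x : continuous f x -> continuous (fun y => - f y) x.
Proof. intros; now apply (continuous_opp f). Qed.

Lemma continuous_Rplus (f g : R -> R) x :
  continuous f x -> continuous g x -> continuous (fun y => f y + g y) x.
Proof. intros; now apply (continuous_plus f g). Qed.

Lemma continuous_Rminus (f g : R -> R) x :
  continuous f x -> continuous g x -> continuous (fun y => f y - g y) x.
Proof. intros; now apply (continuous_minus f g). Qed.

Lemma continuous_Rmult (f g : R -> R) x :
  continuous f x -> continuous g x -> continuous (fun y => f y * g y) x.
Proof. intros; now apply (continuous_mult f g). Qed.

Lemma derive_ext_eventually (f g : R -> R) (x l d : R) :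
  0 < d -> (forall y, Rabs (y - x) < d -> f y = g y) -> is_derive f x l -> is_derive g x l.
Proof.
intros Hd He Hf. apply is_derive_ext_loc with f; auto.
exists (mkposreal d Hd). intros y Hy. apply He, Hy.
Qed.

(** Comparison principle behind the estimates. Differentiability is asked only inside the interval,
    which admits majorants such as x^alpha whose derivative is singular at 0. *)
Lemma derive_le_increment (f g f' g' : R -> R) (a b : R) :
  a <= b ->
  (forall x, a <= x <= b -> continuous f x /\ continuous g x) ->
  (forall x, a < x < b -> is_derive f x (f' x) /\ is_derive g x (g' x) /\ f' x <= g' x) ->
  f b - f a <= g b - g a.
Proof.
intros Hab Hc Hd.
(* [MVT_gen] may return an endpoint, where nothing is known about the derivatives; the value 0 there
   keeps [0 <= d c] true. *)
pose (d x := if Rlt_dec a x then if Rlt_dec x b then g' x - f' x else 0 else 0).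
destruct (MVT_gen (fun x => g x - f x) a b d) as [c [Hc1 Hc2]].
- intros x; rewrite Rmin_left, Rmax_right by lra. intros Hx.
  unfold d. destruct (Rlt_dec a x); [|lra]. destruct (Rlt_dec x b); [|lra].
  destruct (Hd x Hx) as [H1 [H2 _]]. now apply derive_minus.
- intros x; rewrite Rmin_left, Rmax_right by lra. intros Hx.
  apply continuity_pt_continuous. destruct (Hc x Hx). now apply continuous_Rminus.
- assert (0 <= d c).
  { unfold d. destruct (Rlt_dec a c); [|lra]. destruct (Rlt_dec c b); [|lra].
    destruct (Hd c) as [_ [_ H]]; lra. }
  assert (0 <= d c * (b - a)) by (apply Rmult_le_pos; lra). lra.
Qed.

Lemma derive_zero_constant (f : R -> R) (a b : R) :
  a <= b -> (forall x, a <= x <= b -> continuous f x) ->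
  (forall x, a < x < b -> is_derive f x 0) -> f b = f a.
Proof.
intros Hab Hc Hd.
assert (H1 := derive_le_increment f (fun _ => 0) (fun _ => 0) (fun _ => 0) a b Hab).
assert (H2 := derive_le_increment (fun _ => 0) f (fun _ => 0) (fun _ => 0) a b Hab).
cbv beta in H1, H2.
enough (f b - f a <= 0 - 0 /\ 0 - 0 <= f b - f a) by lra.
split; [apply H1 | apply H2]; intros x Hx;
  first [apply conj; auto; apply continuous_const
        |refine (conj _ (conj _ _)); auto using Rle_refl; apply derive_const].
Qed.

(** [E * exp (- W)] does not increase and [E * exp W] does not decrease; the second fact carries
    zero data leftwards. The rate [w] may be unbounded near an endpoint as long as its primitive [W]
    is continuous there. *)
Lemma gronwall (E E' W w : R -> R) (a b : R) :
  a <= b ->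
  (forall x, a <= x <= b -> continuous E x /\ continuous W x) ->
  (forall x, a < x < b -> is_derive E x (E' x) /\ is_derive W x (w x) /\ Rabs (E' x) <= w x * E x) ->
  E b <= E a * exp (W b - W a) /\ E a <= E b * exp (W b - W a).
Proof.
intros Hab Hc Hd.
assert (cexp : forall y, continuous exp y) by (intros; eapply derive_continuous, derive_exp).
split.
- assert (H := derive_le_increment (fun x => E x * exp (- W x)) (fun _ => 0)
     (fun x => (E' x - w x * E x) * exp (- W x)) (fun _ => 0) a b Hab).
  cbv beta in H.
  enough (E b * exp (- W b) <= E a * exp (- W a)) as H0.
  { unfold Rminus; rewrite exp_plus.
    apply Rmult_le_compat_r with (r := exp (W b)) in H0; [|left; apply exp_pos].
    replace (E b * exp (- W b) * exp (W b)) with (E b * (exp (- W b + W b))) in H0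
      by (rewrite exp_plus; ring).
    rewrite Rplus_opp_l, exp_0 in H0. lra. }
  enough (E b * exp (- W b) - E a * exp (- W a) <= 0 - 0) by lra. apply H.
  + intros x Hx; destruct (Hc x Hx). split; [|apply continuous_const].
    apply continuous_Rmult; auto. apply (continuous_comp (fun y => - W y) exp); auto.
    now apply continuous_Ropp.
  + intros x Hx. destruct (Hd x Hx) as [H1 [H2 H3]]. refine (conj _ (conj _ _)).
    * eapply derive_eq. apply derive_mult; [apply H1|].
      apply (derive_comp exp (fun y => - W y)). apply derive_exp. apply (is_derive_opp W), H2.
      unfold opp; simpl; ring.
    * apply derive_const.
    * assert (0 < exp (- W x)) by apply exp_pos. apply Rabs_le_between in H3. nra.
- assert (H := derive_le_increment (fun _ => 0) (fun x => E x * exp (W x)) (fun _ => 0)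
     (fun x => (E' x + w x * E x) * exp (W x)) a b Hab).
  cbv beta in H.
  enough (E a * exp (W a) <= E b * exp (W b)) as H0.
  { unfold Rminus; rewrite exp_plus.
    apply Rmult_le_compat_r with (r := exp (- W a)) in H0; [|left; apply exp_pos].
    replace (E a * exp (W a) * exp (- W a)) with (E a * (exp (W a + - W a))) in H0
      by (rewrite exp_plus; ring).
    rewrite Rplus_opp_r, exp_0 in H0. lra. }
  enough (0 - 0 <= E b * exp (W b) - E a * exp (W a)) by lra. apply H.
  + intros x Hx; destruct (Hc x Hx). split; [apply continuous_const|].
    apply continuous_Rmult; auto. apply (continuous_comp W exp); auto.
  + intros x Hx. destruct (Hd x Hx) as [H1 [H2 H3]]. refine (conj _ (conj _ _)).
    * apply derive_const.
    * eapply derive_eq. apply derive_mult; [apply H1|].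
      apply (derive_comp exp W). apply derive_exp. apply H2. cbv beta; ring.
    * assert (0 < exp (W x)) by apply exp_pos. apply Rabs_le_between in H3. nra.
Qed.

Lemma zero_left_derive (f : R -> R) (x d l : R) :
  0 < d -> (forall y, x - d < y <= x -> f y = 0) -> is_derive f x l -> l = 0.
Proof.
intros Hd0 Hf Hd. apply is_derive_Reals in Hd.
destruct (Req_dec l 0) as [|Hl]; auto. exfalso.
destruct (Hd (Rabs l)) as [e Hde]. now apply Rabs_pos_lt.
assert (Hp := cond_pos e).
set (m := Rmin d e / 2).
assert (Hm : 0 < m) by (unfold m; assert (0 < Rmin d e) by (now apply Rmin_pos); lra).
assert (Hm1 : m < d) by (unfold m in *; generalize (Rmin_l d e); lra).
assert (Hm2 : m < e) by (unfold m in *; generalize (Rmin_r d e); lra).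
assert (Ha : Rabs (- m) < e) by (rewrite Rabs_Ropp, Rabs_pos_eq; lra).
specialize (Hde (- m) ltac:(lra) Ha).
rewrite 2!Hf in Hde by lra.
replace ((0 - 0) / - m - l) with (- l) in Hde by (field; lra).
rewrite Rabs_Ropp in Hde. lra.
Qed.

(* Derivatives and continuity of complex-valued functions of a real variable are handled
   componentwise. *)
Definition Cderive (f : R -> C) (x : R) (l : C) : Prop :=
  is_derive (fun y => fst (f y)) x (fst l) /\ is_derive (fun y => snd (f y)) x (snd l).

Definition Ccontinuous (f : R -> C) (x : R) : Prop :=
  continuous (fun y => fst (f y)) x /\ continuous (fun y => snd (f y)) x.

Lemma Cderive_iff (f : R -> C) (x : R) (l : C) :
  @is_derive R_AbsRing C_R_NormedModule f x l <-> Cderive f x l.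
Proof.
split.
- intros H. split.
  + unfold is_derive.
    apply filterdiff_ext_lin with (fun y : R => fst (scal (V := C_R_NormedModule) y l)); [|reflexivity].
    apply (filterdiff_comp' f (fun t : C_R_NormedModule => fst t)) ; [exact H|].
    apply filterdiff_linear. apply is_linear_fst.
  + unfold is_derive.
    apply filterdiff_ext_lin with (fun y : R => snd (scal (V := C_R_NormedModule) y l)); [|reflexivity].
    apply (filterdiff_comp' f (fun t : C_R_NormedModule => snd t)) ; [exact H|].
    apply filterdiff_linear. apply is_linear_snd.
- intros [H1 H2].
  apply (is_derive_ext (fun y => plus (scal (V := C_R_NormedModule) (fst (f y)) (1, 0))
      (scal (V := C_R_NormedModule) (snd (f y)) (0, 1)))).
  + intros t. unfold plus, scal; simpl. unfold prod_plus, prod_scal; simpl.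
    unfold plus, scal; simpl. unfold mult; simpl. destruct (f t); simpl; f_equal; ring.
  + replace l with (plus (scal (V := C_R_NormedModule) (fst l) (1, 0))
      (scal (V := C_R_NormedModule) (snd l) (0, 1))).
    * apply (is_derive_plus (K := R_AbsRing) (V := C_R_NormedModule)).
      apply (is_derive_scal_l (K := R_AbsRing) (V := C_R_NormedModule)); apply H1.
      apply (is_derive_scal_l (K := R_AbsRing) (V := C_R_NormedModule)); apply H2.
    * unfold plus, scal; simpl. unfold prod_plus, prod_scal; simpl.
      unfold plus, scal; simpl. unfold mult; simpl. destruct l; simpl; f_equal; ring.
Qed.

Lemma Cderive_eq f x a b : Cderive f x a -> a = b -> Cderive f x b.
Proof. now intros H <-. Qed.

Lemma Cderive_plus f g x a b :
  Cderive f x a -> Cderive g x b -> Cderive (fun y => (f y + g y)%C) x (a + b)%C.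
Proof. intros [H1 H2] [H3 H4]; split; simpl; now apply derive_plus. Qed.

Lemma Cderive_minus f g x a b :
  Cderive f x a -> Cderive g x b -> Cderive (fun y => (f y - g y)%C) x (a - b)%C.
Proof. intros [H1 H2] [H3 H4]; split; simpl; now apply derive_minus. Qed.

Lemma Cderive_mult f g x a b :
  Cderive f x a -> Cderive g x b -> Cderive (fun y => (f y * g y)%C) x (a * g x + f x * b)%C.
Proof.
intros [H1 H2] [H3 H4]; split; simpl.
- eapply derive_eq. apply derive_minus; apply derive_mult; eassumption. cbv beta; ring.
- eapply derive_eq. apply derive_plus; apply derive_mult; eassumption. cbv beta; ring.
Qed.

(** This reads u'(0) off from the formula for u on x <= 0 alone; to the right of 0 no closed form is
    available. *)
Lemma Cderive_unique_left (f g : R -> C) (x d : R) (a b : C) :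
  0 < d -> (forall y, x - d < y <= x -> f y = g y) ->
  Cderive f x a -> Cderive g x b -> a = b.
Proof.
intros Hd He [F1 F2] [G1 G2].
apply injective_projections; apply Rminus_diag_uniq.
- apply (zero_left_derive (fun y => fst (f y) - fst (g y)) x d); auto.
  + intros y Hy. rewrite He by auto. ring.
  + now apply derive_minus.
- apply (zero_left_derive (fun y => snd (f y) - snd (g y)) x d); auto.
  + intros y Hy. rewrite He by auto. ring.
  + now apply derive_minus.
Qed.

Lemma Cderive_const c x : Cderive (fun _ => c) x (RtoC 0).
Proof. split; apply derive_const. Qed.

Lemma Cderive_RtoC f x a : is_derive f x a -> Cderive (fun y => RtoC (f y)) x (RtoC a).
Proof. split; simpl; auto. apply derive_const. Qed.

Lemma Cderive_expi f x a :
  is_derive f x a -> Cderive (fun y => expi (f y)) x (Ci * RtoC a * expi (f x))%C.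
Proof.
intros H; split; simpl.
- eapply derive_eq. apply (derive_comp cos f). apply derive_cos. exact H. cbv beta; ring.
- eapply derive_eq. apply (derive_comp sin f). apply derive_sin. exact H. cbv beta; ring.
Qed.

Lemma Cderive_continuous f x l : Cderive f x l -> Ccontinuous f x.
Proof. intros [H1 H2]; split; eapply derive_continuous; eassumption. Qed.

Lemma Ccontinuous_plus f g x :
  Ccontinuous f x -> Ccontinuous g x -> Ccontinuous (fun y => (f y + g y)%C) x.
Proof. intros [H1 H2] [H3 H4]; split; simpl; now apply continuous_Rplus. Qed.

Lemma Ccontinuous_minus f g x :
  Ccontinuous f x -> Ccontinuous g x -> Ccontinuous (fun y => (f y - g y)%C) x.
Proof. intros [H1 H2] [H3 H4]; split; simpl; now apply continuous_Rminus. Qed.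

Lemma Ccontinuous_mult f g x :
  Ccontinuous f x -> Ccontinuous g x -> Ccontinuous (fun y => (f y * g y)%C) x.
Proof.
intros [H1 H2] [H3 H4]; split; simpl.
- apply continuous_Rminus; now apply continuous_Rmult.
- apply continuous_Rplus; now apply continuous_Rmult.
Qed.

Lemma Ccontinuous_const c x : Ccontinuous (fun _ => c) x.
Proof. eapply Cderive_continuous, Cderive_const. Qed.

Lemma Ccontinuous_RtoC f x : continuous f x -> Ccontinuous (fun y => RtoC (f y)) x.
Proof. split; simpl; auto. apply continuous_const. Qed.

Lemma Ccontinuous_expi f x : continuous f x -> Ccontinuous (fun y => expi (f y)) x.
Proof.
intros H; split; simpl.
- apply (continuous_comp f cos); auto. eapply derive_continuous, derive_cos.
- apply (continuous_comp f sin); auto. eapply derive_continuous, derive_sin.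
Qed.

#[local] Opaque is_derive continuous.

Lemma Cmod_sq (z : C) : Cmod z ^ 2 = fst z ^ 2 + snd z ^ 2.
Proof.
unfold Cmod. rewrite pow2_sqrt; auto.
apply Rplus_le_le_0_compat; apply pow2_ge_0.
Qed.

Lemma Cdot_le_Cmod (z w : C) : Rabs (fst z * fst w + snd z * snd w) <= Cmod z * Cmod w.
Proof.
apply Rsqr_incr_0_var; [|apply Rmult_le_pos; apply Cmod_ge_0].
rewrite <- Rsqr_abs. unfold Rsqr.
replace (Cmod z * Cmod w * (Cmod z * Cmod w)) with (Cmod z ^ 2 * Cmod w ^ 2) by ring.
rewrite !Cmod_sq. assert (0 <= (fst z * snd w - snd z * fst w) ^ 2) by apply pow2_ge_0. nra.
Qed.

(* The projection of [F] on the direction [F b - F a] is a real function, to which the real mean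
   value inequality applies. *)
Lemma Cmean_value (F F' : R -> C) (W w : R -> R) (a b : R) :
  a <= b ->
  (forall x, a <= x <= b -> Ccontinuous F x /\ continuous W x) ->
  (forall x, a < x < b -> Cderive F x (F' x) /\ is_derive W x (w x) /\ Cmod (F' x) <= w x) ->
  Cmod (F b - F a)%C <= W b - W a.
Proof.
intros Hab Hc Hd.
set (D := (F b - F a)%C).
assert (H := derive_le_increment (fun x => fst D * fst (F x) + snd D * snd (F x))
   (fun x => Cmod D * W x)
   (fun x => fst D * fst (F' x) + snd D * snd (F' x)) (fun x => Cmod D * w x) a b Hab).
cbv beta in H.
assert (HD := Cmod_ge_0 D).
assert (Hs : Cmod D ^ 2 <= Cmod D * (W b - W a)).
{ rewrite Cmod_sq. replace (fst D ^ 2 + snd D ^ 2) with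
   (fst D * fst (F b) + snd D * snd (F b) - (fst D * fst (F a) + snd D * snd (F a))).
  2:{ unfold D; simpl; ring. }
  rewrite Rmult_minus_distr_l. apply H.
  - intros x Hx. destruct (Hc x Hx) as [[H1 H2] H3]. split.
    + apply continuous_Rplus; apply continuous_Rmult; auto; apply continuous_const.
    + apply continuous_Rmult; auto; apply continuous_const.
  - intros x Hx. destruct (Hd x Hx) as [[H1 H2] [H3 H4]]. refine (conj _ (conj _ _)).
    + apply derive_plus; apply derive_scale; assumption.
    + apply derive_scale; assumption.
    + eapply Rle_trans; [apply Rle_abs|]. eapply Rle_trans; [apply Cdot_le_Cmod|].
      now apply Rmult_le_compat_l. }
destruct (Req_dec (Cmod D) 0) as [H0|H0].
- rewrite H0. enough (0 - 0 <= W b - W a) by lra.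
  apply (derive_le_increment (fun _ => 0) W (fun _ => 0) w); auto.
  + intros x Hx; split; [apply continuous_const|]. now apply Hc.
  + intros x Hx; destruct (Hd x Hx) as [_ [H2 H3]].
    refine (conj _ (conj H2 _)); [apply derive_const|].
    eapply Rle_trans; [apply Cmod_ge_0|apply H3].
- apply Rmult_le_reg_l with (Cmod D); [lra|]. lra.
Qed.

Lemma Cmod_expi (x : R) : Cmod (expi x) = 1.
Proof.
unfold Cmod, expi; simpl.
replace (cos x * (cos x * 1) + sin x * (sin x * 1)) with 1. apply sqrt_1.
generalize (sin2_cos2 x). unfold Rsqr. lra.
Qed.

Lemma Cmod_Ci : Cmod Ci = 1.
Proof.
unfold Cmod; simpl. replace (0 * (0 * 1) + 1 * (1 * 1)) with 1 by ring. apply sqrt_1.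
Qed.

Lemma expi_plus (x y : R) : expi (x + y) = (expi x * expi y)%C.
Proof.
unfold expi. rewrite cos_plus, sin_plus. apply injective_projections; simpl; ring.
Qed.

Lemma expi_0 : expi 0 = RtoC 1.
Proof. unfold expi. now rewrite cos_0, sin_0. Qed.

Lemma expi_opp (x : R) : (expi x * expi (- x))%C = RtoC 1.
Proof. now rewrite <- expi_plus, Rplus_opp_r, expi_0. Qed.

Lemma expi_lipschitz (x y : R) : Cmod (expi y - expi x)%C <= Rabs (y - x).
Proof.
assert (H : forall x y, x <= y -> Cmod (expi y - expi x)%C <= y - x).
{ intros a b Hab.
  apply (Cmean_value expi (fun x => Ci * RtoC 1 * expi x)%C (fun x => x) (fun _ => 1)); auto.
  - intros z _. split; [|apply continuous_id]. apply (Ccontinuous_expi (fun y => y)), continuous_id.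
  - intros z _. refine (conj _ (conj _ _)); [|apply derive_id|].
    apply (Cderive_expi (fun y => y)), derive_id.
    rewrite !Cmod_mult, Cmod_expi, Cmod_1, Cmod_Ci. lra. }
destruct (Rle_dec x y).
- rewrite Rabs_pos_eq by lra; auto.
- rewrite Rabs_left by lra. rewrite <- Cmod_opp.
  replace (- (expi y - expi x))%C with (expi x - expi y)%C by ring.
  replace (- (y - x)) with (x - y) by ring. apply H; lra.
Qed.

(** * The oscillatory form of Euler's integral *)

Lemma Rpower_pos (x y : R) : 0 < Rpower x y.
Proof. apply exp_pos. Qed.

Lemma exp_le (x y : R) : x <= y -> exp x <= exp y.
Proof. intros [H| ->]; [left; now apply exp_increasing|apply Rle_refl]. Qed.

Lemma Rpower_small_at_infinity (c eps : R) :
  c < 0 -> 0 < eps -> exists L0, 0 < L0 /\ forall L, L0 <= L -> Rpower L c <= eps.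
Proof.
intros Hc He. exists (exp (ln eps / c)). split; [apply exp_pos|]. intros L HL.
assert (HL0 := exp_pos (ln eps / c)).
unfold Rpower. rewrite <- (exp_ln eps) at 1 by auto. apply exp_le.
assert (H : ln eps / c <= ln L).
{ rewrite <- (ln_exp (ln eps / c)). destruct HL as [HL|<-]; [left; apply ln_increasing; lra|lra]. }
replace (ln eps) with (c * (ln eps / c)) by (field; lra). nra.
Qed.

Lemma Rpower_small_at_0 (c eps : R) :
  0 < c -> 0 < eps -> exists d, 0 < d /\ forall x, 0 < x <= d -> Rpower x c <= eps.
Proof.
intros Hc He. exists (exp (ln eps / c)). split; [apply exp_pos|]. intros x [Hx0 Hx].
unfold Rpower. rewrite <- (exp_ln eps) at 1 by auto. apply exp_le.
assert (H : ln x <= ln eps / c).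
{ rewrite <- (ln_exp (ln eps / c)). destruct Hx as [Hx|<-]; [left; apply ln_increasing; lra|lra]. }
replace (ln eps) with (c * (ln eps / c)) by (field; lra). nra.
Qed.

Lemma pos_part_pow_nonneg (b s : R) : 0 <= pos_part_pow b s.
Proof. unfold pos_part_pow. destruct (Rlt_dec 0 s); [left; apply Rpower_pos|lra]. Qed.

Lemma pos_part_pow_pos (b s : R) : 0 < s -> pos_part_pow b s = Rpower s b.
Proof. intros H; unfold pos_part_pow. destruct (Rlt_dec 0 s); [auto|lra]. Qed.

Lemma pos_part_pow_npos (b s : R) : s <= 0 -> pos_part_pow b s = 0.
Proof. intros H; unfold pos_part_pow. destruct (Rlt_dec 0 s); [lra|auto]. Qed.

Lemma continuous_eq_near (f g : R -> R) (x d : R) :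
  0 < d -> (forall y, Rabs (y - x) < d -> f y = g y) -> continuous f x -> continuous g x.
Proof.
intros Hd He Hf. apply continuous_ext_loc with f; auto.
exists (mkposreal d Hd). intros y Hy. apply He, Hy.
Qed.

Lemma derive_pos_part_pow (b s : R) :
  0 < s -> is_derive (pos_part_pow b) s (b * Rpower s (b - 1)).
Proof.
intros Hs. apply (derive_ext_eventually (fun y => Rpower y b)) with s; auto.
- intros y Hy. apply Rabs_def2 in Hy. rewrite pos_part_pow_pos; auto; lra.
- now apply derive_Rpower.
Qed.

Lemma continuous_pos_part_pow (b s : R) : 0 < b -> continuous (pos_part_pow b) s.
Proof.
intros Hb. destruct (total_order_T s 0) as [[Hs|Hs]|Hs].
- apply (continuous_eq_near (fun _ => 0)) with (- s); [lra| |apply continuous_const].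
  intros y Hy. apply Rabs_def2 in Hy. rewrite pos_part_pow_npos; auto; lra.
- subst s. apply continuous_eps. intros eps He.
  destruct (Rpower_small_at_0 b (eps / 2)) as [d [Hd H]]; auto; [lra|].
  exists d; split; auto. intros y Hy. rewrite Rminus_0_r in Hy.
  rewrite (pos_part_pow_npos b 0), Rminus_0_r by lra. apply Rabs_def2 in Hy.
  destruct (Rle_dec y 0).
  + rewrite pos_part_pow_npos, Rabs_R0; lra.
  + rewrite pos_part_pow_pos by lra. specialize (H y). rewrite Rabs_pos_eq; [lra|].
    left; apply Rpower_pos.
- eapply derive_continuous, derive_pos_part_pow, Hs.
Qed.

Lemma mult_Rpower_pred (b s : R) : 0 < s -> s * Rpower s (b - 1) = Rpower s b.
Proof.
intros Hs. rewrite <- (Rpower_1 s) at 1 by auto. rewrite <- Rpower_plus. f_equal; ring.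
Qed.

Lemma derive_RInt_upper (f : R -> R) (a x : R) :
  (forall y, continuous f y) -> is_derive (fun y => RInt f a y) x (f x).
Proof.
intros Hf. apply (is_derive_RInt f (fun y => RInt f a y) a x); auto.
apply filter_forall. intros y. apply (RInt_correct f a y).
apply (ex_RInt_continuous f a y). auto.
Qed.

Lemma RInt_same (f : R -> R) (a : R) : RInt f a a = 0.
Proof. apply (RInt_point a f). Qed.

(* The integrand [exp (- e^{-i theta} s^b)] whose integral over [0, oo) is rotated from
   [theta = 0], where it is Euler's, to [theta = PI / 2], where it is oscillatory. *)
Definition rot_re (b theta s : R) : R :=
  exp (- cos theta * pos_part_pow b s) * cos (sin theta * pos_part_pow b s).
Definition rot_im (b theta s : R) : R :=
  exp (- cos theta * pos_part_pow b s) * sin (sin theta * pos_part_pow b s).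

(** With k = exp (- (c - i d) f), these are the real and imaginary parts of k' = - (c - i d) f'
    k. *)
Lemma derive_rot_comp (f : R -> R) (c d x l : R) :
  is_derive f x l ->
  is_derive (fun s => exp (- c * f s) * cos (d * f s)) x
    (l * (- c * (exp (- c * f x) * cos (d * f x)) - d * (exp (- c * f x) * sin (d * f x)))) /\
  is_derive (fun s => exp (- c * f s) * sin (d * f s)) x
    (l * (- c * (exp (- c * f x) * sin (d * f x)) + d * (exp (- c * f x) * cos (d * f x)))).
Proof.
intros H. split.
- eapply derive_eq.
  apply (derive_mult (fun s => exp (- c * f s)) (fun s => cos (d * f s))).
  apply (derive_comp exp (fun s => - c * f s)); [apply derive_exp|apply derive_scale, H].
  apply (derive_comp cos (fun s => d * f s)); [apply derive_cos|apply derive_scale, H].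
  cbv beta; ring.
- eapply derive_eq.
  apply (derive_mult (fun s => exp (- c * f s)) (fun s => sin (d * f s))).
  apply (derive_comp exp (fun s => - c * f s)); [apply derive_exp|apply derive_scale, H].
  apply (derive_comp sin (fun s => d * f s)); [apply derive_sin|apply derive_scale, H].
  cbv beta; ring.
Qed.

Lemma continuous_rot_comp (f : R -> R) (c d x : R) :
  continuous f x ->
  continuous (fun s => exp (- c * f s) * cos (d * f s)) x /\
  continuous (fun s => exp (- c * f s) * sin (d * f s)) x.
Proof.
intros H.
destruct (derive_rot_comp (fun s => s) c d (f x) 1 (derive_id _)) as [H1 H2].
split.
- apply (continuous_comp f (fun s => exp (- c * s) * cos (d * s))); auto.
  eapply derive_continuous, H1.
- apply (continuous_comp f (fun s => exp (- c * s) * sin (d * s))); auto.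
  eapply derive_continuous, H2.
Qed.

(** Real and imaginary parts of dk/dtheta = i e^{-i theta} s^b k, for the rotated integrand k. *)
Lemma derive_rot_theta (b th s : R) :
  is_derive (fun t => rot_re b t s) th
    (pos_part_pow b s * (sin th * rot_re b th s - cos th * rot_im b th s)) /\
  is_derive (fun t => rot_im b t s) th
    (pos_part_pow b s * (cos th * rot_re b th s + sin th * rot_im b th s)).
Proof.
unfold rot_re, rot_im. set (p := pos_part_pow b s).
assert (H1 : is_derive (fun t => exp (- cos t * p)) th (sin th * p * exp (- cos th * p))).
{ apply (derive_comp exp (fun t => - cos t * p)); [apply derive_exp|].
  eapply derive_eq. apply (derive_mult (fun t => - cos t) (fun _ => p)).
  apply derive_opp, derive_cos. apply derive_const. cbv beta; ring. }
assert (H2 : is_derive (fun t => sin t * p) th (cos th * p)).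
{ eapply derive_eq. apply (derive_mult sin (fun _ => p)). apply derive_sin. apply derive_const.
  cbv beta; ring. }
split.
- eapply derive_eq. apply (derive_mult _ (fun t => cos (sin t * p))). apply H1.
  apply (derive_comp cos (fun t => sin t * p)); [apply derive_cos|apply H2]. cbv beta; ring.
- eapply derive_eq. apply (derive_mult _ (fun t => sin (sin t * p))). apply H1.
  apply (derive_comp sin (fun t => sin t * p)); [apply derive_sin|apply H2]. cbv beta; ring.
Qed.

Lemma continuous_rot (b th s : R) :
  0 < b -> continuous (rot_re b th) s /\ continuous (rot_im b th) s.
Proof. intros Hb. apply (continuous_rot_comp (pos_part_pow b)). now apply continuous_pos_part_pow. Qed.

Lemma continuity_2d_fst (f : R -> R) (x y : R) : continuous f x -> continuity_2d_pt (fun u _ => f u) x y.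
Proof.
intros H. apply (continuity_1d_2d_pt_comp f (fun u _ => u)).
- now apply continuity_pt_continuous.
- apply continuity_2d_pt_id1.
Qed.

Lemma continuity_2d_snd (f : R -> R) (x y : R) : continuous f y -> continuity_2d_pt (fun _ v => f v) x y.
Proof.
intros H. apply (continuity_1d_2d_pt_comp f (fun _ v => v)).
- now apply continuity_pt_continuous.
- apply continuity_2d_pt_id2.
Qed.

Lemma continuity_2d_rot (b th s : R) :
  0 < b ->
  continuity_2d_pt (fun u v => rot_re b u v) th s /\
  continuity_2d_pt (fun u v => rot_im b u v) th s.
Proof.
intros Hb.
assert (Hp : continuity_2d_pt (fun _ v => pos_part_pow b v) th s).
{ apply continuity_2d_snd. now apply continuous_pos_part_pow. }
assert (Hc : continuity_2d_pt (fun u _ => - cos u) th s).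
{ apply continuity_2d_pt_opp, continuity_2d_fst. eapply derive_continuous, derive_cos. }
assert (Hs : continuity_2d_pt (fun u _ => sin u) th s).
{ apply continuity_2d_fst. eapply derive_continuous, derive_sin. }
assert (He : continuity_2d_pt (fun u v => exp (- cos u * pos_part_pow b v)) th s).
{ apply (continuity_1d_2d_pt_comp exp (fun u v => - cos u * pos_part_pow b v)).
  - apply continuity_pt_continuous. exact (derive_continuous exp _ _ (derive_exp _)).
  - now apply continuity_2d_pt_mult. }
split; apply continuity_2d_pt_mult; auto.
- apply (continuity_1d_2d_pt_comp cos (fun u v => sin u * pos_part_pow b v)).
  + apply continuity_pt_continuous. exact (derive_continuous cos _ _ (derive_cos _)).
  + now apply continuity_2d_pt_mult.
- apply (continuity_1d_2d_pt_comp sin (fun u v => sin u * pos_part_pow b v)).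
  + apply continuity_pt_continuous. exact (derive_continuous sin _ _ (derive_sin _)).
  + now apply continuity_2d_pt_mult.
Qed.

Lemma derive_RInt_param (f df : R -> R -> R) (a b x : R) :
  (forall u v, is_derive (fun z => f z v) u (df u v)) ->
  (forall v, continuity_2d_pt df x v) ->
  (forall u v, continuous (f u) v) ->
  is_derive (fun u => RInt (f u) a b) x (RInt (df x) a b).
Proof.
intros Hd Hc Hf.
eapply derive_eq.
- apply (is_derive_RInt_param f a b x).
  + apply filter_forall. intros u t _. exists (df u t). apply Hd.
  + intros t _. apply continuity_2d_pt_ext with df; auto.
    intros u v. symmetry. apply is_derive_unique, Hd.
  + apply filter_forall. intros u. apply (ex_RInt_continuous (f u)). auto.
- apply RInt_ext. intros t _. apply is_derive_unique, Hd.
Qed.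

Definition rot_int (b theta L : R) : C := (RInt (rot_re b theta) 0 L, RInt (rot_im b theta) 0 L).

(* With [k] the integrand, [d/dtheta k = (i / b) (k - d/ds (s k))], so the [theta]-derivative of the
   integral only involves a boundary term. *)
Lemma derive_rot_int (b th L : R) :
  0 < b -> 0 <= L ->
  Cderive (fun t => rot_int b t L) th
    (Ci * RtoC (/ b) * (rot_int b th L - RtoC L * (rot_re b th L, rot_im b th L)))%C.
Proof.
intros Hb HL.
pose (dr := fun t s => pos_part_pow b s * (sin t * rot_re b t s - cos t * rot_im b t s)).
pose (di := fun t s => pos_part_pow b s * (cos t * rot_re b t s + sin t * rot_im b t s)).
assert (H2r : forall s, continuity_2d_pt dr th s /\ continuity_2d_pt di th s).
{ intros s. destruct (continuity_2d_rot b th s Hb) as [H1 H2].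
  assert (Hp : continuity_2d_pt (fun _ v => pos_part_pow b v) th s).
  { apply continuity_2d_snd. now apply continuous_pos_part_pow. }
  assert (Hc : continuity_2d_pt (fun u _ => cos u) th s).
  { apply continuity_2d_fst. eapply derive_continuous, derive_cos. }
  assert (Hs : continuity_2d_pt (fun u _ => sin u) th s).
  { apply continuity_2d_fst. eapply derive_continuous, derive_sin. }
  split; apply continuity_2d_pt_mult; auto;
    [apply continuity_2d_pt_minus|apply continuity_2d_pt_plus]; now apply continuity_2d_pt_mult. }
assert (Cr : forall s, continuous (rot_re b th) s) by (intros; now apply continuous_rot).
assert (Ci' : forall s, continuous (rot_im b th) s) by (intros; now apply continuous_rot).
assert (Cd : forall s, continuous (dr th) s /\ continuous (di th) s).
{ intros s. assert (Hp : continuous (pos_part_pow b) s) by now apply continuous_pos_part_pow.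
  split; apply continuous_Rmult; auto; [apply continuous_Rminus|apply continuous_Rplus];
    apply continuous_Rmult; auto; apply continuous_const. }
(* Euler's identity for the homogeneous function x^b: it trades the factor s^b produced by d/dtheta
   for s d/ds. *)
assert (Hps : forall x, 0 < x -> x * (b * Rpower x (b - 1)) = b * pos_part_pow b x).
{ intros x Hx. rewrite pos_part_pow_pos by auto. rewrite <- (mult_Rpower_pred b x) by auto. ring. }
split; cbn [rot_int fst snd].
- eapply derive_eq. apply (derive_RInt_param (rot_re b) dr).
  + intros u v. apply derive_rot_theta.
  + apply H2r.
  + intros u v. now apply continuous_rot.
  (* The real part of the claim, moved to one side and viewed as a function of the upper endpoint:
     [D 0] is 0 and the derivative vanishes for x > 0. At 0 itself only continuity is used, since
     x^b need not be differentiable there. *)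
  + pose (D := fun x => RInt (dr th) 0 x + / b * (RInt (rot_im b th) 0 x - x * rot_im b th x)).
    enough (HD : D L = D 0).
    { unfold D in HD. rewrite !RInt_same in HD. unfold rot_int; simpl. lra. }
    apply derive_zero_constant; auto.
    * intros x _. apply continuous_Rplus; [|apply continuous_Rmult; [apply continuous_const|]].
      { eapply derive_continuous, derive_RInt_upper. apply Cd. }
      apply continuous_Rminus.
      { eapply derive_continuous, derive_RInt_upper. apply Ci'. }
      apply continuous_Rmult; [apply continuous_id|apply Ci'].
    * intros x Hx.
      destruct (derive_rot_comp (pos_part_pow b) (cos th) (sin th) x _
        (derive_pos_part_pow b x (proj1 Hx))) as [_ Hi].
      eapply derive_eq. apply derive_plus. apply derive_RInt_upper. apply Cd.
      apply derive_scale. apply derive_minus. apply derive_RInt_upper. apply Ci'.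
      apply (derive_mult (fun y => y)). apply derive_id. apply Hi.
      cbv beta. fold (rot_re b th x). fold (rot_im b th x).
      unfold dr. apply Rmult_eq_reg_l with b; [|lra].
      transitivity (b * (pos_part_pow b x * (sin th * rot_re b th x - cos th * rot_im b th x))
         + (x * (b * Rpower x (b - 1))) * (cos th * rot_im b th x - sin th * rot_re b th x)).
      field; lra.
      rewrite Hps by lra. ring.
- eapply derive_eq. apply (derive_RInt_param (rot_im b) di).
  + intros u v. apply derive_rot_theta.
  + apply H2r.
  + intros u v. now apply continuous_rot.
  + pose (D := fun x => RInt (di th) 0 x - / b * (RInt (rot_re b th) 0 x - x * rot_re b th x)).
    enough (HD : D L = D 0).
    { unfold D in HD. rewrite !RInt_same in HD. unfold rot_int; simpl. lra. }
    apply derive_zero_constant; auto.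
    * intros x _. apply continuous_Rminus; [|apply continuous_Rmult; [apply continuous_const|]].
      { eapply derive_continuous, derive_RInt_upper. apply Cd. }
      apply continuous_Rminus.
      { eapply derive_continuous, derive_RInt_upper. apply Cr. }
      apply continuous_Rmult; [apply continuous_id|apply Cr].
    * intros x Hx.
      destruct (derive_rot_comp (pos_part_pow b) (cos th) (sin th) x _
        (derive_pos_part_pow b x (proj1 Hx))) as [Hr _].
      eapply derive_eq. apply derive_minus. apply derive_RInt_upper. apply Cd.
      apply derive_scale. apply derive_minus. apply derive_RInt_upper. apply Cr.
      apply (derive_mult (fun y => y)). apply derive_id. apply Hr.
      cbv beta. fold (rot_re b th x). fold (rot_im b th x).
      unfold di. apply Rmult_eq_reg_l with b; [|lra].
      transitivity (b * (pos_part_pow b x * (cos th * rot_re b th x + sin th * rot_im b th x))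
         - (x * (b * Rpower x (b - 1))) * (cos th * rot_re b th x + sin th * rot_im b th x)).
      field; lra.
      rewrite Hps by lra. ring.
Qed.

Lemma Cmod_rot (b th s : R) :
  Cmod (rot_re b th s, rot_im b th s) = exp (- cos th * pos_part_pow b s).
Proof.
replace (rot_re b th s, rot_im b th s)
  with (RtoC (exp (- cos th * pos_part_pow b s)) * expi (sin th * pos_part_pow b s))%C.
- rewrite Cmod_mult, Cmod_expi, Rmult_1_r, Cmod_R. apply Rabs_pos_eq. left; apply exp_pos.
- unfold rot_re, rot_im, expi, Cmult; simpl. f_equal; ring.
Qed.

(* The bound on the arc uses that [sin] or [cos] is at least [1/2] at each angle. *)
Lemma rot_int_rotation (b L : R) :
  0 < b -> 0 < L ->
  Cmod (expi (- / b * (PI / 2)) * rot_int b (PI / 2) L - rot_int b 0 L)%C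
    <= / b * (6 * Rpower L (1 - b)).
Proof.
intros Hb HL.
set (M := Rpower L b). assert (HM : 0 < M) by apply Rpower_pos.
assert (HPI := PI_RGT_0). assert (HPI4 := PI_4).
(* The factor e^{-i t / b} integrates away the term (i / b) [rot_int] of the derivative, so that
   only the boundary term on the arc remains. *)
pose (F := fun t => (expi (- / b * t) * rot_int b t L)%C).
pose (B := fun t => / b * L * (2 * / M * exp (- cos t * M) + t * exp (- / 2 * M))).
apply Rle_trans with (B (PI / 2) - B 0).
- assert (HF := Cmean_value F
    (fun t => Copp (Ci * RtoC (/ b) * expi (- / b * t) * (RtoC L * (rot_re b t L, rot_im b t L))))%C B
    (fun t => / b * L * (2 * / M * (sin t * M * exp (- cos t * M)) + exp (- / 2 * M)))
    0 (PI / 2)).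
  replace (expi (- / b * (PI / 2)) * rot_int b (PI / 2) L - rot_int b 0 L)%C
    with (F (PI / 2)%R - F 0%R)%C.
  2:{ unfold F. rewrite Rmult_0_r, expi_0. ring. }
  assert (HDF : forall t, Cderive F t
    (Copp (Ci * RtoC (/ b) * expi (- / b * t) * (RtoC L * (rot_re b t L, rot_im b t L))))%C).
  { intros t. eapply Cderive_eq.
    - apply Cderive_mult.
      + apply (Cderive_expi (fun t => - / b * t)). apply derive_scale, derive_id.
      + apply derive_rot_int; lra.
    - rewrite Rmult_1_r, RtoC_opp. ring. }
  assert (HDB : forall t, is_derive B t
    (/ b * L * (2 * / M * (sin t * M * exp (- cos t * M)) + exp (- / 2 * M)))).
  { intros t. unfold B. apply derive_scale, derive_plus.
    - apply derive_scale.
      eapply derive_eq. apply (derive_comp exp (fun t => - cos t * M)). apply derive_exp.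
      apply (derive_mult (fun t => - cos t) (fun _ => M)).
      apply derive_opp, derive_cos. apply derive_const. cbv beta; ring.
    - eapply derive_eq. apply (derive_mult (fun t => t) (fun _ => exp (- / 2 * M))).
      apply derive_id. apply derive_const. cbv beta; ring. }
  apply HF; [lra| |].
  + intros t _. split; [eapply Cderive_continuous, HDF|eapply derive_continuous, HDB].
  + intros t Ht. refine (conj (HDF t) (conj (HDB t) _)).
    rewrite Cmod_opp, !Cmod_mult, Cmod_rot, Cmod_expi, !Cmod_R.
    rewrite Cmod_Ci.
    assert (Hib : 0 < / b) by now apply Rinv_0_lt_compat.
    rewrite (Rabs_pos_eq (/ b)), (Rabs_pos_eq L) by lra.
    rewrite pos_part_pow_pos by auto. fold M.
    rewrite Rmult_1_l, Rmult_1_r, Rmult_assoc.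
    replace (2 * / M * (sin t * M * exp (- cos t * M))) with (2 * sin t * exp (- cos t * M))
      by (field; lra).
    rewrite Rmult_assoc.
    apply Rmult_le_compat_l; [lra|]. apply Rmult_le_compat_l; [lra|].
    assert (0 < sin t) by (apply sin_gt_0; lra).
    assert (0 < cos t) by (apply cos_gt_0; lra).
    assert (He := exp_pos (- cos t * M)). assert (He2 := exp_pos (- / 2 * M)).
    destruct (Rle_dec (/ 2) (sin t)).
    * nra.
    * assert (/ 2 <= cos t).
      { assert (H1 := sin2_cos2 t). unfold Rsqr in H1. nra. }
      assert (exp (- cos t * M) <= exp (- / 2 * M)) by (apply exp_le; nra).
      assert (0 <= 2 * sin t * exp (- cos t * M)) by nra. lra.
- assert (Hib : 0 < / b) by now apply Rinv_0_lt_compat.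
  unfold B. rewrite cos_PI2, Ropp_0, !Rmult_0_l, exp_0.
  replace (Rpower L (1 - b)) with (L * / M).
  2:{ unfold M. rewrite <- Rpower_Ropp. rewrite <- (Rpower_1 L) at 1 by auto.
      rewrite <- Rpower_plus. f_equal; ring. }
  assert (HiM : 0 < / M) by now apply Rinv_0_lt_compat.
  assert (He : exp (- / 2 * M) <= 2 * / M).
  { replace (- / 2 * M) with (- (/ 2 * M)) by ring. rewrite exp_Ropp.
    replace (2 * / M) with (/ (/ 2 * M)) by (field; lra).
    apply Rinv_le_contravar; [lra|]. generalize (exp_ineq1_le (/ 2 * M)). lra. }
  assert (He0 := exp_pos (- cos 0 * M)). assert (He2 := exp_pos (- / 2 * M)).
  (* With [PI <= 4] the second summand is at most 2 * (2 / M), whence 6 = 2 + 4. *)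
  assert (H3 : 2 * / M * 1 + PI / 2 * exp (- / 2 * M) <= 6 * / M) by nra.
  assert (H4 : 0 <= 2 * / M * exp (- cos 0 * M)) by nra.
  assert (H5 : 0 <= / b * L) by nra.
  nra.
Qed.

(** The integral increases with L and stays bounded, because e^{-s^b} <= e^{-s} for s >= 1; its
    limit is the supremum. Positivity of the limit matters later, when one divides by the leading
    term of R. *)
Lemma stretched_exp_integral (b : R) :
  1 < b ->
  exists G, 0 < G /\
    forall eps, 0 < eps -> exists L0, 0 < L0 /\
      forall L, L0 <= L -> Rabs (RInt (fun s => exp (- pos_part_pow b s)) 0 L - G) <= eps.
Proof.
intros Hb.
set (e := fun s => exp (- pos_part_pow b s)).
assert (Ce : forall s, continuous e s).
{ intros s. apply (continuous_comp (fun s => - pos_part_pow b s) exp).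
  - apply continuous_Ropp, continuous_pos_part_pow. lra.
  - eapply derive_continuous, derive_exp. }
set (E := fun L : R => RInt e 0 L : R).
assert (DE : forall x, is_derive E x (e x)) by (intros; now apply derive_RInt_upper).
assert (E0 : E 0 = 0) by apply RInt_same.
assert (Hinc : forall x y, x <= y -> E x <= E y).
{ intros x y Hxy. enough (0 - 0 <= E y - E x) by lra.
  apply (derive_le_increment (fun _ => 0) E (fun _ => 0) e); auto.
  - intros z _; split; [apply continuous_const|eapply derive_continuous, DE].
  - intros z _. refine (conj (derive_const _ _) (conj (DE z) _)). left; apply exp_pos. }
assert (Htail : forall L, 1 <= L -> E L - E 1 <= - exp (- L) - - exp (- 1)).
{ intros L HL.
  assert (Hde : forall z, is_derive (fun s => - exp (- s)) z (exp (- z))).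
  { intros z. eapply derive_eq. apply (derive_opp (fun s => exp (- s))).
    apply (derive_comp exp (fun s => - s)). apply derive_exp. apply derive_opp, derive_id.
    cbv beta; ring. }
  apply (derive_le_increment E (fun s => - exp (- s)) e (fun s => exp (- s))); auto.
  - intros z _; split; [eapply derive_continuous, DE|eapply derive_continuous, Hde].
  - intros z Hz. refine (conj (DE z) (conj (Hde z) _)).
    apply exp_le. rewrite pos_part_pow_pos by lra.
    assert (H1 : Rpower z 1 <= Rpower z b) by (apply Rle_Rpower; lra).
    rewrite Rpower_1 in H1 by lra. lra. }
set (A := fun y => exists L, y = E L).
destruct (completeness A) as [G [HG1 HG2]].
- exists (E 1 + exp (- 1)). intros y [L ->].
  assert (H1 := exp_pos (- 1)).
  destruct (Rle_dec 1 L) as [HL|HL].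
  + specialize (Htail L HL). assert (H := exp_pos (- L)). lra.
  + specialize (Hinc L 1). lra.
- exists 0, 0. now rewrite E0.
- exists G. split.
  + apply Rlt_le_trans with (E 1); [|apply HG1; now exists 1].
    apply Rlt_le_trans with (exp (- 1)); [apply exp_pos|].
    enough (exp (- 1) * 1 - exp (- 1) * 0 <= E 1 - E 0) by lra.
    apply (derive_le_increment (fun x => exp (- 1) * x) E (fun _ => exp (- 1) * 1) e); [lra| |].
    * intros z _; split; [|eapply derive_continuous, DE].
      apply continuous_Rmult; [apply continuous_const|apply continuous_id].
    * intros z Hz. refine (conj (derive_scale _ _ _ _ (derive_id _)) (conj (DE z) _)).
      rewrite Rmult_1_r. apply exp_le. rewrite pos_part_pow_pos by lra.
      enough (Rpower z b <= 1) by lra. unfold Rpower. rewrite <- exp_0. apply exp_le.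
      assert (ln z < ln 1) by (apply ln_increasing; lra). rewrite ln_1 in H. nra.
  + intros eps He.
    destruct (classic (exists L, G - eps <= E L)) as [[L HL]|Hn].
    * exists (Rmax 1 L). split; [apply Rlt_le_trans with 1; [lra|apply Rmax_l]|].
      intros K HK. assert (HLK : L <= K) by (eapply Rle_trans; [apply Rmax_r|apply HK]).
      specialize (Hinc L K HLK). assert (E K <= G) by (apply HG1; now exists K).
      apply Rabs_le. fold (E K). lra.
    * assert (G <= G - eps); [|lra]. apply HG2. intros y [L ->].
      destruct (Rle_dec (G - eps) (E L)); [|lra]. exfalso; apply Hn; now exists L.
Qed.

(** Integration by parts turns the integral of t^alpha e^{-t} into that of alpha t^{alpha - 1}
    e^{-t}, and s = t^alpha turns the latter into that of exp (- s^{1/alpha}). Both moves are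
    contained in the single primitive [P]. *)
Lemma Gamma_as_stretched_exp (al G : R) :
  0 < al < 1 ->
  (forall eps, 0 < eps -> exists L0, 0 < L0 /\
     forall L, L0 <= L -> Rabs (RInt (fun s => exp (- pos_part_pow (/ al) s)) 0 L - G) <= eps) ->
  Gamma (al + 1) = G.
Proof.
intros Hal HG.
assert (Hib : 1 < / al) by (rewrite <- Rinv_1 at 1; apply Rinv_lt_contravar; lra).
set (e := fun s => exp (- pos_part_pow (/ al) s)).
assert (Ce : forall s, continuous e s).
{ intros s. apply (continuous_comp (fun s => - pos_part_pow (/ al) s) exp).
  - apply continuous_Ropp, continuous_pos_part_pow. lra.
  - eapply derive_continuous, derive_exp. }
set (E := fun L : R => RInt e 0 L : R). change (forall eps, 0 < eps -> exists L0, 0 < L0 /\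
     forall L, L0 <= L -> Rabs (E L - G) <= eps) in HG.
assert (DE : forall x, is_derive E x (e x)) by (intros; now apply derive_RInt_upper).
assert (E0 : E 0 = 0) by apply RInt_same.
assert (HE : forall x, 0 <= x -> 0 <= E x <= x).
{ intros x Hx.
  enough (0 - 0 <= E x - E 0 /\ E x - E 0 <= x - 0) by lra. split.
  - apply (derive_le_increment (fun _ => 0) E (fun _ => 0) e); auto.
    + intros z _; split; [apply continuous_const|eapply derive_continuous, DE].
    + intros z _. refine (conj (derive_const _ _) (conj (DE z) _)). left; apply exp_pos.
  - apply (derive_le_increment E (fun x => x) e (fun _ => 1)); auto.
    + intros z _; split; [eapply derive_continuous, DE|apply continuous_id].
    + intros z _. refine (conj (DE z) (conj (derive_id _) _)).
      rewrite <- exp_0. apply exp_le. generalize (pos_part_pow_nonneg (/ al) z). lra. }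
set (P := fun t => E (Rpower t al) - Rpower t al * exp (- t)).
set (p := fun t => Rpower t (al + 1 - 1) * exp (- t)).
assert (DP : forall t, 0 < t -> is_derive P t (p t)).
{ intros t Ht. eapply derive_eq. apply derive_minus.
  - apply (derive_comp E (fun t => Rpower t al)); [apply DE|now apply derive_Rpower].
  - apply (derive_mult (fun t => Rpower t al) (fun t => exp (- t))).
    now apply derive_Rpower.
    apply (derive_comp exp (fun s => - s)). apply derive_exp. apply derive_opp, derive_id.
  - cbv beta. unfold e, p. rewrite pos_part_pow_pos, Rpower_mult, Rinv_r, Rpower_1 by
      (try apply Rpower_pos; lra).
    replace (al + 1 - 1) with al by ring. ring. }
assert (Cp : forall t, 0 < t -> continuous p t).
{ intros t Ht. apply continuous_Rmult.
  - eapply derive_continuous, derive_Rpower, Ht.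
  - apply (continuous_comp (fun s => - s) exp); [apply continuous_Ropp, continuous_id|].
    eapply derive_continuous, derive_exp. }
assert (Hpos : filter_prod (at_right 0) (Rbar_locally p_infty) (fun ab : R * R =>
    forall x, Rmin (fst ab) (snd ab) <= x <= Rmax (fst ab) (snd ab) -> 0 < x)).
{ exists (fun a => 0 < a) (fun b => 0 < b).
  - exists (mkposreal 1 Rlt_0_1). intros y _ Hy; exact Hy.
  - exists 0. auto.
  - intros x y Hx Hy z [Hz _]; simpl in *.
    eapply Rlt_le_trans; [|apply Hz]. now apply Rmin_pos. }
unfold Gamma. fold p. apply is_RInt_gen_unique.
replace G with (G - 0) by ring.
apply (is_RInt_gen_ext (Derive P)).
{ revert Hpos. apply filter_imp. intros ab H x Hx. apply is_derive_unique, DP, H. lra. }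
apply (is_RInt_gen_Derive P 0 G).
- revert Hpos. apply filter_imp. intros ab H x Hx. exists (p x). now apply DP, H.
- revert Hpos. apply filter_imp. intros ab H x Hx. assert (Hx0 := H x Hx).
  apply (continuous_eq_near p) with x; auto.
  intros y Hy. apply Rabs_def2 in Hy. symmetry. apply is_derive_unique, DP. lra.
- apply filterlim_locally. intros eps.
  destruct (Rpower_small_at_0 al (eps / 2)) as [d [Hd H]]; [lra|generalize (cond_pos eps); lra|].
  exists (mkposreal d Hd). intros y Hb Hy. assert (Hy2 : Rabs (y - 0) < d) by apply Hb.
  rewrite Rminus_0_r, Rabs_pos_eq in Hy2 by lra.
  specialize (H y). assert (Hr := Rpower_pos y al).
  specialize (HE (Rpower y al)).
  assert (Hey : exp (- y) <= 1) by (rewrite <- exp_0; apply exp_le; lra).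
  assert (Hey0 := exp_pos (- y)). assert (He := cond_pos eps).
  change (Rabs (P y - 0) < eps). unfold P. apply Rabs_def1; nra.
- apply filterlim_locally. intros eps. assert (He := cond_pos eps).
  destruct (HG (eps / 2)) as [L0 [HL0 H]]; [lra|].
  (* The three thresholds give t^alpha <= t, t^alpha >= [L0], and t e^{-t} <= 4 / t < eps / 2, the
     last one from t^2 <= 4 e^t. *)
  exists (Rmax (Rmax 1 (Rpower L0 (/ al))) (8 / eps)). intros t Ht.
  assert (Ht1 : Rmax 1 (Rpower L0 (/ al)) < t) by (eapply Rle_lt_trans; [apply Rmax_l|apply Ht]).
  assert (Ht2 : 8 / eps < t) by (eapply Rle_lt_trans; [apply Rmax_r|apply Ht]).
  assert (Ht3 : 1 < t) by (eapply Rle_lt_trans; [apply Rmax_l|apply Ht1]).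
  assert (Ht4 : Rpower L0 (/ al) < t) by (eapply Rle_lt_trans; [apply Rmax_r|apply Ht1]).
  assert (HL : L0 <= Rpower t al).
  { rewrite <- (Rpower_1 L0) by auto. replace 1 with (/ al * al) by (field; lra).
    rewrite <- Rpower_mult. apply Rle_Rpower_l; [lra|]. split; [apply Rpower_pos|lra]. }
  specialize (H _ HL). apply Rabs_le_between in H.
  assert (Hta : Rpower t al <= t).
  { rewrite <- (Rpower_1 t) at 2 by lra. apply Rle_Rpower; lra. }
  assert (Hex : t * t <= 4 * exp t).
  { replace t with (t / 2 + t / 2) at 3 by field. rewrite exp_plus.
    generalize (exp_ineq1_le (t / 2)). nra. }
  assert (Hee : exp (- t) * exp t = 1) by (rewrite <- exp_plus, Rplus_opp_l; apply exp_0).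
  assert (Hey0 := exp_pos (- t)).
  assert (Htt : t * (t * exp (- t)) <= 4) by nra.
  assert (Heps : 8 < t * eps).
  { apply Rmult_lt_compat_r with (r := eps) in Ht2; auto.
    unfold Rdiv in Ht2. rewrite Rmult_assoc, Rinv_l in Ht2 by lra. lra. }
  assert (Hte : t * exp (- t) < eps / 2) by nra.
  assert (Hr := Rpower_pos t al).
  change (Rabs (P t - G) < eps). unfold P. apply Rabs_def1; nra.
Qed.

(** Rotating the ray by [PI / 2] multiplies the limit by e^{i alpha pi / 2}. The arc contributes
    O(L^{1 - 1/alpha}), which tends to 0 since alpha < 1. *)
Lemma oscillatory_Gamma_integral (al : R) :
  0 < al < 1 ->
  0 < Gamma (al + 1) /\
  forall eps, 0 < eps -> exists L0, 0 < L0 /\ forall L, L0 <= L ->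
    Cmod (rot_int (/ al) (PI / 2) L - expi (al * PI / 2) * RtoC (Gamma (al + 1)))%C <= eps.
Proof.
intros Hal.
assert (Hib : 1 < / al) by (rewrite <- Rinv_1 at 1; apply Rinv_lt_contravar; lra).
destruct (stretched_exp_integral (/ al) Hib) as [G [HG H]].
rewrite (Gamma_as_stretched_exp al G Hal H). split; auto.
intros eps He.
destruct (H (eps / 2)) as [L1 [HL1 H1]]; [lra|].
destruct (Rpower_small_at_infinity (1 - / al) (eps / 2 / 6)) as [L2 [HL2 H2]]; [lra|lra|].
exists (Rmax L1 L2). split; [eapply Rlt_le_trans; [apply HL1|apply Rmax_l]|].
intros L HL.
assert (HLL1 : L1 <= L) by (eapply Rle_trans; [apply Rmax_l|apply HL]).
assert (HLL2 : L2 <= L) by (eapply Rle_trans; [apply Rmax_r|apply HL]).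
specialize (H1 L HLL1). specialize (H2 L HLL2).
assert (Hr := rot_int_rotation (/ al) L). rewrite Rinv_inv in Hr.
specialize (Hr ltac:(lra) ltac:(lra)).
assert (H0 : rot_int (/ al) 0 L = RtoC (RInt (fun s => exp (- pos_part_pow (/ al) s)) 0 L)).
{ unfold rot_int, RtoC. f_equal.
  - apply RInt_ext. intros s _. unfold rot_re. rewrite cos_0, sin_0, Rmult_0_l, cos_0.
    rewrite Rmult_1_r. f_equal. ring.
  - rewrite (RInt_ext _ (fun _ => 0)).
    + rewrite RInt_const. apply Rmult_0_r.
    + intros s _. unfold rot_im. rewrite sin_0, Rmult_0_l, sin_0. apply Rmult_0_r. }
rewrite H0 in Hr. set (I := RInt (fun s => exp (- pos_part_pow (/ al) s)) 0 L) in *.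
rewrite <- (Rmult_1_l (Cmod _)), <- (Cmod_expi (- al * (PI / 2))), <- Cmod_mult.
replace (expi (- al * (PI / 2)) * (rot_int (/ al) (PI / 2) L - expi (al * PI / 2) * RtoC G))%C
  with ((expi (- al * (PI / 2)) * rot_int (/ al) (PI / 2) L - RtoC I) + RtoC (I - G))%C.
- eapply Rle_trans; [apply Cmod_triangle|]. rewrite Cmod_R.
  assert (Hp := Rpower_pos L (1 - / al)). nra.
- rewrite RtoC_minus.
  assert (H3 : (expi (- al * (PI / 2)) * expi (al * PI / 2))%C = RtoC 1).
  { rewrite <- expi_plus, <- expi_0. f_equal. field. }
  transitivity (expi (- al * (PI / 2)) * rot_int (/ al) (PI / 2) L - RtoC 1 * RtoC G)%C; [ring|].
  rewrite <- H3. ring.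
Qed.

(** * Solutions of the Schroedinger equation *)

Lemma geometric_increments_limit (a : nat -> R) (B : R) :
  (forall n, Rabs (a (S n) - a n) <= B * (/ 2) ^ n) ->
  forall n, Rabs (a n - real (Lim_seq a)) <= 2 * B * (/ 2) ^ n.
Proof.
intros H.
assert (HB : 0 <= B).
{ specialize (H O). simpl in H. generalize (Rabs_pos (a 1%nat - a O)). lra. }
assert (Hp : forall n, 0 < (/ 2) ^ n) by (intros; apply pow_lt; lra).
assert (Hm : forall n m, Rabs (a (n + m)%nat - a n) <= 2 * B * (/ 2) ^ n).
{ intros n m.
  (* The factor 1 - 2^{-m}, dropped afterwards, makes the induction on m close. *)
  assert (Rabs (a (n + m)%nat - a n) <= 2 * B * (/ 2) ^ n * (1 - (/ 2) ^ m)).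
  - induction m as [|m IH].
    + rewrite Nat.add_0_r, Rminus_diag, Rabs_R0. simpl. lra.
    + rewrite Nat.add_succ_r. specialize (H (n + m)%nat).
      replace (a (S (n + m)) - a n) with ((a (S (n + m)) - a (n + m)%nat) + (a (n + m)%nat - a n)) by ring.
      eapply Rle_trans; [apply Rabs_triang|].
      rewrite pow_add in H. simpl. nra.
  - assert (Hm := Hp m). assert (Hn := Hp n). assert (0 <= B * (/ 2) ^ n) by nra. nra. }
assert (Hex : ex_finite_lim_seq a).
{ apply ex_lim_seq_cauchy_corr. intros eps. assert (He := cond_pos eps).
  destruct (pow_lt_1_zero (/ 2)) with (y := eps / (4 * B + 1)) as [N HN].
  - rewrite Rabs_pos_eq; lra.
  - apply Rdiv_lt_0_compat; lra.
  - exists N. intros n m Hn Hm'.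
    specialize (HN N (Nat.le_refl N)). rewrite Rabs_pos_eq in HN by (left; apply Hp).
    assert (H1 := Hm N (n - N)%nat). assert (H2 := Hm N (m - N)%nat).
    replace (N + (n - N))%nat with n in H1 by lia. replace (N + (m - N))%nat with m in H2 by lia.
    assert (H3 : (/ 2) ^ N * (4 * B + 1) < eps).
    { apply Rmult_lt_compat_r with (r := 4 * B + 1) in HN; [|lra].
      unfold Rdiv in HN. rewrite Rmult_assoc, Rinv_l, Rmult_1_r in HN by lra. exact HN. }
    specialize (Hp N). apply Rabs_le_between in H1. apply Rabs_le_between in H2.
    apply Rabs_def1; nra. }
intros n.
assert (Hl : is_lim_seq (fun m => Rabs (a (m + n)%nat - a n)) (Rabs (real (Lim_seq a) - a n))).
{ apply (is_lim_seq_abs _ (Finite (real (Lim_seq a) - a n))).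
  apply is_lim_seq_minus'; [|apply is_lim_seq_const].
  apply (is_lim_seq_incr_n a). now apply Lim_seq_correct'. }
rewrite Rabs_minus_sym.
apply (is_lim_seq_le _ (fun _ => 2 * B * (/ 2) ^ n) (Rabs (real (Lim_seq a) - a n)) (2 * B * (/ 2) ^ n)) in Hl.
- exact Hl.
- intros m. rewrite Nat.add_comm. apply Hm.
- apply is_lim_seq_const.
Qed.

Fixpoint picard (q : R -> R) (c y0 z0 : R) (n : nat) : (R -> R) * (R -> R) :=
  match n with
  | O => (fun _ => 0, fun _ => 0)
  | S m => (fun x => y0 + RInt (snd (picard q c y0 z0 m)) c x,
            fun x => z0 + RInt (fun s => q s * fst (picard q c y0 z0 m) s) c x)
  end.

Lemma picard_continuous q c y0 z0 n :
  (forall x, continuous q x) ->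
  forall x, continuous (fst (picard q c y0 z0 n)) x /\ continuous (snd (picard q c y0 z0 n)) x.
Proof.
intros Hq. induction n as [|n IH]; intros x; simpl.
- split; apply continuous_const.
- split; apply continuous_Rplus; try apply continuous_const.
  + eapply derive_continuous, derive_RInt_upper. apply IH.
  + eapply derive_continuous, (derive_RInt_upper (fun s => q s * fst (picard q c y0 z0 n) s)).
    intros y. apply continuous_Rmult; [apply Hq|apply IH].
Qed.

(** The weight is a smooth substitute for e^{lam |x - c|}, as in Bielecki's norm. Its primitive from
    c is a difference of the same exponentials divided by [lam], so each integration gains 1 / [lam]
    on the whole line. *)
Lemma RInt_exp_weight_bound (f : R -> R) (c lam B : R) :
  0 < lam -> (forall x, continuous f x) ->
  (forall x, Rabs (f x) <= B * (exp (lam * (x - c)) + exp (- lam * (x - c)))) ->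
  forall x, Rabs (RInt f c x) <= B / lam * (exp (lam * (x - c)) + exp (- lam * (x - c))).
Proof.
intros Hl Cf Hf.
assert (HB : 0 <= B).
{ specialize (Hf c). rewrite Rminus_diag, !Rmult_0_r, exp_0 in Hf.
  generalize (Rabs_pos (f c)). lra. }
set (F := fun x : R => RInt f c x : R).
assert (DF : forall x, is_derive F x (f x)) by (intros; now apply derive_RInt_upper).
assert (F0 : F c = 0) by apply RInt_same.
set (W := fun x => B / lam * (exp (lam * (x - c)) - exp (- lam * (x - c)))).
assert (DW : forall x, is_derive W x (B * (exp (lam * (x - c)) + exp (- lam * (x - c))))).
{ intros x.
  assert (Hk : forall k, is_derive (fun y => exp (k * (y - c))) x (k * exp (k * (x - c)))).
  { intros k. eapply derive_eq. apply (derive_comp exp (fun y => k * (y - c))). apply derive_exp.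
    apply derive_scale, derive_minus. apply derive_id. apply derive_const. cbv beta; ring. }
  eapply derive_eq. apply derive_scale, derive_minus; apply Hk. cbv beta. field. lra. }
assert (W0 : W c = 0) by (unfold W; rewrite Rminus_diag, !Rmult_0_r; ring).
assert (HFW : forall x y, x <= y -> Rabs (F y - F x) <= W y - W x).
{ intros x y Hxy. rewrite <- Cmod_R, RtoC_minus.
  apply (Cmean_value (fun x => RtoC (F x)) (fun x => RtoC (f x)) W
    (fun x => B * (exp (lam * (x - c)) + exp (- lam * (x - c))))); auto.
  - intros z _; split; [apply Ccontinuous_RtoC|]; eapply derive_continuous; auto.
  - intros z _. refine (conj (Cderive_RtoC _ _ _ (DF z)) (conj (DW z) _)).
    rewrite Cmod_R. apply Hf. }
intros x. fold (F x).
assert (H1 := exp_pos (lam * (x - c))). assert (H2 := exp_pos (- lam * (x - c))).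
assert (H3 : 0 <= B / lam) by (apply Rdiv_le_0_compat; lra).
assert (HWx : W x = B / lam * (exp (lam * (x - c)) - exp (- lam * (x - c)))) by reflexivity.
destruct (Rle_dec c x) as [Hx|Hx].
- specialize (HFW c x Hx). rewrite F0, W0, !Rminus_0_r in HFW. nra.
- specialize (HFW x c ltac:(lra)). rewrite F0, W0, Rminus_0_l, Rabs_Ropp in HFW. nra.
Qed.

(** The rate 2 (1 + Q) is chosen so that 1 / lam and Q / lam are both at most 1/2: in the weighted
    norm the Picard map halves distances globally, and no patching of local solutions is needed. *)
Lemma picard_increment q Q c y0 z0 n :
  (forall x, continuous q x) -> (forall x, Rabs (q x) <= Q) ->
  forall x,
    Rabs (fst (picard q c y0 z0 (S n)) x - fst (picard q c y0 z0 n) x) <=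
      (Rabs y0 + Rabs z0) * (exp (2 * (1 + Q) * (x - c)) + exp (- (2 * (1 + Q)) * (x - c))) * (/ 2) ^ n /\
    Rabs (snd (picard q c y0 z0 (S n)) x - snd (picard q c y0 z0 n) x) <=
      (Rabs y0 + Rabs z0) * (exp (2 * (1 + Q) * (x - c)) + exp (- (2 * (1 + Q)) * (x - c))) * (/ 2) ^ n.
Proof.
intros Cq Hq.
assert (HQ : 0 <= Q) by (eapply Rle_trans; [apply Rabs_pos|apply (Hq 0)]).
set (lam := 2 * (1 + Q)). set (K := Rabs y0 + Rabs z0).
set (w := fun x => exp (lam * (x - c)) + exp (- lam * (x - c))).
assert (Ky := Rabs_pos y0). assert (Kz := Rabs_pos z0).
assert (Hw : forall x, 1 <= w x).
{ intros x. unfold w. generalize (exp_ineq1_le (lam * (x - c))) (exp_ineq1_le (- lam * (x - c))). lra. }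
assert (Hex : forall f : R -> R, (forall x, continuous f x) -> forall a b, ex_RInt f a b).
{ intros f Cf a b. apply (ex_RInt_continuous f). auto. }
induction n as [|n IH]; intros x.
- specialize (Hw x). fold (w x). simpl.
  rewrite (RInt_ext (fun s => q s * 0) (fun _ => 0)) by (intros; apply Rmult_0_r).
  rewrite !RInt_const. change (scal (x - c) 0) with ((x - c) * 0).
  rewrite !Rmult_0_r, !Rplus_0_r, !Rminus_0_r, Rmult_1_r. unfold K. nra.
- assert (Cn := picard_continuous q c y0 z0 n Cq).
  assert (Cn1 := picard_continuous q c y0 z0 (S n) Cq).
  set (p1 := picard q c y0 z0 (S n)) in *. set (p0 := picard q c y0 z0 n) in *.
  fold (w x).
  assert (Hhalf : / lam <= / 2) by (apply Rinv_le_contravar; unfold lam; lra).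
  assert (Hilam : 0 < / lam) by (apply Rinv_0_lt_compat; unfold lam; lra).
  assert (Hpw : 0 < (/ 2) ^ n) by (apply pow_lt; lra).
  split.
  + replace (fst (picard q c y0 z0 (S (S n))) x - fst p1 x) with (RInt (fun s => snd p1 s - snd p0 s) c x).
    * eapply Rle_trans.
      { apply (RInt_exp_weight_bound _ c lam (K * (/ 2) ^ n)); [unfold lam; lra| |].
        - intros y. apply continuous_Rminus; [apply Cn1|apply Cn].
        - intros y. destruct (IH y) as [_ H]. fold (w y) in H |- *. lra. }
      fold (w x). specialize (Hw x). simpl. unfold Rdiv.
      assert (0 <= K * w x * (/ 2) ^ n).
      { apply Rmult_le_pos; [apply Rmult_le_pos|]; unfold K; lra. }
      nra.
    * rewrite (RInt_minus (snd p1) (snd p0)) by (apply Hex; intros; first [apply Cn1|apply Cn]).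
      unfold minus, plus, opp; simpl. fold p1. fold p0. ring.
  + replace (snd (picard q c y0 z0 (S (S n))) x - snd p1 x)
      with (RInt (fun s => q s * fst p1 s - q s * fst p0 s) c x).
    * eapply Rle_trans.
      { apply (RInt_exp_weight_bound _ c lam (Q * (K * (/ 2) ^ n))); [unfold lam; lra| |].
        - intros y. apply continuous_Rminus; apply continuous_Rmult; auto; [apply Cn1|apply Cn].
        - intros y. destruct (IH y) as [H _]. fold (w y) in H |- *.
          rewrite <- Rmult_minus_distr_l, Rabs_mult, Rmult_assoc.
          apply Rmult_le_compat; try apply Rabs_pos; auto. lra. }
      fold (w x). specialize (Hw x). simpl. unfold Rdiv.
      assert (0 <= K * w x * (/ 2) ^ n).
      { apply Rmult_le_pos; [apply Rmult_le_pos|]; unfold K; lra. }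
      assert (Q * / lam <= / 2).
      { apply Rmult_le_reg_r with lam; [unfold lam; lra|].
        rewrite Rmult_assoc, Rinv_l by (unfold lam; lra). unfold lam; lra. }
      nra.
    * rewrite (RInt_minus (fun s => q s * fst p1 s) (fun s => q s * fst p0 s))
        by (apply Hex; intros; apply continuous_Rmult; first [apply Cq|apply Cn1|apply Cn]).
      unfold minus, plus, opp; simpl. fold p1. fold p0. ring.
Qed.

Lemma linear_ode_exists (q : R -> R) (Q c y0 z0 : R) :
  (forall x, continuous q x) -> (forall x, Rabs (q x) <= Q) ->
  exists y z : R -> R,
    y c = y0 /\ z c = z0 /\
    forall x, is_derive y x (z x) /\ is_derive z x (q x * y x).
Proof.
intros Cq Hq.
assert (HQ : 0 <= Q) by (eapply Rle_trans; [apply Rabs_pos|apply (Hq 0)]).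
set (Y := fun n => fst (picard q c y0 z0 n)). set (Z := fun n => snd (picard q c y0 z0 n)).
set (lam := 2 * (1 + Q)). set (K := Rabs y0 + Rabs z0).
assert (HK : 0 <= K) by (unfold K; generalize (Rabs_pos y0) (Rabs_pos z0); lra).
set (w := fun x => exp (lam * (x - c)) + exp (- lam * (x - c))).
set (y := fun x => real (Lim_seq (fun n => Y n x))).
set (z := fun x => real (Lim_seq (fun n => Z n x))).
assert (Hy : forall n x, Rabs (Y n x - y x) <= 2 * (K * w x) * (/ 2) ^ n).
{ intros n x. apply (geometric_increments_limit (fun n => Y n x)). intros m.
  apply (picard_increment q Q c y0 z0 m Cq Hq x). }
assert (Hz : forall n x, Rabs (Z n x - z x) <= 2 * (K * w x) * (/ 2) ^ n).
{ intros n x. apply (geometric_increments_limit (fun n => Z n x)). intros m.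
  apply (picard_increment q Q c y0 z0 m Cq Hq x). }
assert (Cn : forall n x, continuous (Y n) x /\ continuous (Z n) x).
{ intros n x. now apply picard_continuous. }
assert (Hw : forall r x, Rabs (x - c) < r -> w x <= 2 * exp (lam * r)).
{ intros r x Hr. apply Rabs_def2 in Hr. unfold w.
  assert (exp (lam * (x - c)) <= exp (lam * r)) by (apply exp_le; unfold lam; nra).
  assert (exp (- lam * (x - c)) <= exp (lam * r)) by (apply exp_le; unfold lam; nra). lra. }
assert (Hpow : forall B eps, 0 <= B -> 0 < eps -> exists N, forall n, (N <= n)%nat -> B * (/ 2) ^ n < eps).
{ intros B eps HB He. destruct (pow_lt_1_zero (/ 2)) with (y := eps / (B + 1)) as [N HN].
  - rewrite Rabs_pos_eq; lra.
  - apply Rdiv_lt_0_compat; lra.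
  - exists N. intros n Hn. specialize (HN n Hn).
    assert (0 < (/ 2) ^ n) by (apply pow_lt; lra).
    rewrite Rabs_pos_eq in HN by lra.
    apply Rmult_lt_compat_r with (r := B + 1) in HN; [|lra].
    unfold Rdiv in HN. rewrite Rmult_assoc, Rinv_l, Rmult_1_r in HN by lra. nra. }
assert (HB : forall r, 0 <= 2 * (K * (2 * exp (lam * r)))).
{ intros r. generalize (exp_pos (lam * r)). intros. apply Rmult_le_pos; [lra|].
  apply Rmult_le_pos; lra. }
assert (Hcv : forall r x n, Rabs (x - c) < r -> 2 * (K * w x) * (/ 2) ^ n <= 2 * (K * (2 * exp (lam * r))) * (/ 2) ^ n).
{ intros r x n Hr. apply Rmult_le_compat_r; [left; apply pow_lt; lra|].
  apply Rmult_le_compat_l; [lra|]. apply Rmult_le_compat_l; auto. }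
exists y, z. split; [|split].
(* Iterate 0 is the zero pair and ignores the initial data; every later iterate takes the prescribed
   value at c. *)
- unfold y. rewrite <- Lim_seq_incr_1. rewrite (Lim_seq_ext _ (fun _ => y0)).
  + now rewrite Lim_seq_const.
  + intros n. unfold Y; simpl. rewrite RInt_same. ring.
- unfold z. rewrite <- Lim_seq_incr_1. rewrite (Lim_seq_ext _ (fun _ => z0)).
  + now rewrite Lim_seq_const.
  + intros n. unfold Z; simpl. rewrite RInt_same. ring.
- intros x.
  set (r := Rabs (x - c) + 1). assert (Hr0 : 0 < r) by (unfold r; generalize (Rabs_pos (x - c)); lra).
  assert (Hx : Boule c (mkposreal r Hr0) x) by (unfold Boule, r; simpl; lra).
  split; apply is_derive_Reals.
  (* The derivative of [Y (S n)] is exactly [Z n], hence the shift. The ball is centred at c, where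
     the weight is centred, and is wide enough to contain x. *)
  + apply (CVU_derivable (fun n => Y (S n)) Z y z c (mkposreal r Hr0)); auto.
    * intros eps He. destruct (Hpow _ eps (HB r) He) as [N HN]. exists N. intros n t Hn Ht.
      rewrite Rabs_minus_sym. eapply Rle_lt_trans; [apply Hz|].
      eapply Rle_lt_trans; [now apply (Hcv r)|]. now apply HN.
    * intros t Ht eps He. destruct (Hpow _ eps (HB r) He) as [N HN]. exists N. intros n Hn.
      unfold Rdist. eapply Rle_lt_trans; [apply Hy|].
      eapply Rle_lt_trans; [now apply (Hcv r)|]. apply HN. lia.
    * intros n t Ht. apply is_derive_Reals. eapply derive_eq.
      { apply (derive_plus (fun _ => y0) (fun t => RInt (Z n) c t)). apply derive_const.
        apply derive_RInt_upper. apply Cn. }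
      ring.
  + apply (CVU_derivable (fun n => Z (S n)) (fun n t => q t * Y n t) z (fun t => q t * y t) c
      (mkposreal r Hr0)); auto.
    * intros eps He.
      destruct (Hpow (Q * (2 * (K * (2 * exp (lam * r))))) eps) as [N HN]; auto.
      { apply Rmult_le_pos; auto. }
      exists N. intros n t Hn Ht.
      rewrite <- Rmult_minus_distr_l, Rabs_mult, Rabs_minus_sym.
      eapply Rle_lt_trans; [|apply (HN n Hn)]. rewrite Rmult_assoc.
      apply Rmult_le_compat; try apply Rabs_pos; auto.
      eapply Rle_trans; [apply Hy|]. now apply (Hcv r).
    * intros t Ht eps He. destruct (Hpow _ eps (HB r) He) as [N HN]. exists N. intros n Hn.
      unfold Rdist. eapply Rle_lt_trans; [apply Hz|].
      eapply Rle_lt_trans; [now apply (Hcv r)|]. apply HN. lia.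
    * intros n t Ht. apply is_derive_Reals. eapply derive_eq.
      { apply (derive_plus (fun _ => z0) (fun t => RInt (fun s => q s * Y n s) c t)). apply derive_const.
        apply (derive_RInt_upper (fun s => q s * Y n s)). intros s. apply continuous_Rmult; auto. apply Cn. }
      cbv beta; ring.
Qed.

(** Gronwall for |u|^2 + |u'|^2, whose derivative 2 (1 + q) Re (conj u u') is at most (1 + Q) times
    itself in absolute value. Zero data travel in both directions. *)
Lemma Code_unique (q : R -> R) (Q a b : R) (u u1 : R -> C) :
  a <= b ->
  (forall x, a <= x <= b -> Ccontinuous u x /\ Ccontinuous u1 x) ->
  (forall x, a < x < b ->
     Cderive u x (u1 x) /\ Cderive u1 x (RtoC (q x) * u x)%C /\ Rabs (q x) <= Q) ->
  (u a = RtoC 0 /\ u1 a = RtoC 0 -> u b = RtoC 0 /\ u1 b = RtoC 0) /\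
  (u b = RtoC 0 /\ u1 b = RtoC 0 -> u a = RtoC 0 /\ u1 a = RtoC 0).
Proof.
intros Hab Hc Hd.
set (E := fun x => fst (u x) * fst (u x) + snd (u x) * snd (u x)
                   + (fst (u1 x) * fst (u1 x) + snd (u1 x) * snd (u1 x))).
destruct (gronwall E
  (fun x => 2 * (1 + q x) * (fst (u x) * fst (u1 x) + snd (u x) * snd (u1 x)))
  (fun x => (1 + Q) * x) (fun x => (1 + Q) * 1) a b Hab) as [H1 H2].
- intros x Hx. destruct (Hc x Hx) as [[C1 C2] [C3 C4]]. split.
  + unfold E. apply continuous_Rplus; apply continuous_Rplus; now apply continuous_Rmult.
  + apply continuous_Rmult; [apply continuous_const|apply continuous_id].
- intros x Hx. destruct (Hd x Hx) as [[D1 D2] [[D3 D4] HQ]].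
  refine (conj _ (conj (derive_scale _ _ _ _ (derive_id _)) _)).
  + eapply derive_eq. apply derive_plus; apply derive_plus; apply derive_mult;
      first [exact D1|exact D2|exact D3|exact D4]. simpl. ring.
  + rewrite !Rabs_mult, (Rabs_pos_eq 2) by lra.
    assert (Ha : Rabs (1 + q x) <= 1 + Q).
    { eapply Rle_trans; [apply Rabs_triang|]. rewrite Rabs_R1. lra. }
    assert (Hb : 2 * Rabs (fst (u x) * fst (u1 x) + snd (u x) * snd (u1 x)) <= E x).
    { unfold E. assert (H1 := Rle_0_sqr (fst (u x) - fst (u1 x))).
      assert (H2 := Rle_0_sqr (snd (u x) - snd (u1 x))).
      assert (H3 := Rle_0_sqr (fst (u x) + fst (u1 x))).
      assert (H4 := Rle_0_sqr (snd (u x) + snd (u1 x))). unfold Rsqr in *.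
      unfold Rabs; destruct Rcase_abs; lra. }
    generalize (Rabs_pos (fst (u x) * fst (u1 x) + snd (u x) * snd (u1 x))).
    generalize (Rabs_pos (1 + q x)). nra.
- assert (E0 : forall x, E x = 0 -> u x = RtoC 0 /\ u1 x = RtoC 0).
  { intros x Hx. unfold E in Hx.
    assert (G1 := Rle_0_sqr (fst (u x))). assert (G2 := Rle_0_sqr (snd (u x))).
    assert (G3 := Rle_0_sqr (fst (u1 x))). assert (G4 := Rle_0_sqr (snd (u1 x))).
    fold (Rsqr (fst (u x))) in Hx. fold (Rsqr (snd (u x))) in Hx.
    fold (Rsqr (fst (u1 x))) in Hx. fold (Rsqr (snd (u1 x))) in Hx.
    assert (Rsqr (fst (u x)) = 0) by lra. assert (Rsqr (snd (u x)) = 0) by lra.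
    assert (Rsqr (fst (u1 x)) = 0) by lra. assert (Rsqr (snd (u1 x)) = 0) by lra.
    rewrite (surjective_pairing (u x)), (surjective_pairing (u1 x)).
    split; apply injective_projections; simpl; now apply Rsqr_0_uniq. }
  assert (Ep : forall x, 0 <= E x).
  { intros x. unfold E. generalize (Rle_0_sqr (fst (u x))) (Rle_0_sqr (snd (u x)))
      (Rle_0_sqr (fst (u1 x))) (Rle_0_sqr (snd (u1 x))). unfold Rsqr. lra. }
  split; intros [Z1 Z2]; apply E0.
  + assert (Z : E a = 0) by (unfold E; rewrite Z1, Z2; simpl; ring).
    rewrite Z, Rmult_0_l in H1. generalize (Ep b). lra.
  + assert (Z : E b = 0) by (unfold E; rewrite Z1, Z2; simpl; ring).
    rewrite Z, Rmult_0_l in H2. generalize (Ep a). lra.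
Qed.

Definition Csolution (q : R -> R) (u u1 : R -> C) : Prop :=
  forall x, Cderive u x (u1 x) /\ Cderive u1 x (RtoC (q x) * u x)%C.

Lemma Csolution_continuous q u u1 x :
  Csolution q u u1 -> Ccontinuous u x /\ Ccontinuous u1 x.
Proof. intros H; destruct (H x); split; eapply Cderive_continuous; eassumption. Qed.

Lemma Cderive_cmul (c l : C) f x : Cderive f x l -> Cderive (fun y => (c * f y)%C) x (c * l)%C.
Proof.
intros H. eapply Cderive_eq. apply Cderive_mult. apply Cderive_const. exact H. cbv beta; ring.
Qed.

Lemma Csolution_combination q u u1 v v1 (a b : C) :
  Csolution q u u1 -> Csolution q v v1 ->
  Csolution q (fun x => (a * u x + b * v x)%C) (fun x => (a * u1 x + b * v1 x)%C).
Proof.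
intros Hu Hv x. destruct (Hu x) as [U1 U2], (Hv x) as [V1 V2]. split.
- apply Cderive_plus; now apply Cderive_cmul.
- eapply Cderive_eq. apply Cderive_plus; apply Cderive_cmul; eassumption. ring.
Qed.

Lemma Csolution_zero q Q u u1 c :
  (forall x, Rabs (q x) <= Q) -> Csolution q u u1 -> u c = RtoC 0 -> u1 c = RtoC 0 ->
  forall x, u x = RtoC 0 /\ u1 x = RtoC 0.
Proof.
intros HQ Hs H0 H1 x.
assert (HC := fun x => Csolution_continuous q u u1 x Hs).
destruct (Rle_dec c x).
- apply (Code_unique q Q c x u u1); auto. intros z _. destruct (Hs z); auto.
- apply (Code_unique q Q x c u u1); auto; [lra|]. intros z _. destruct (Hs z); auto.
Qed.

(** * Plane waves, the conserved current and the scattering solution *)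

Definition plane (k : R) (a b : C) (x : R) : C :=
  (a * expi (k * x) + b * expi (- k * x))%C.

Definition plane1 (k : R) (a b : C) (x : R) : C :=
  (a * (Ci * RtoC k * expi (k * x)) + b * (Ci * RtoC (- k) * expi (- k * x)))%C.

Lemma Csolution_plane (k : R) (a b : C) :
  Csolution (fun _ => - k ^ 2) (plane k a b)
   (plane1 k a b).
Proof.
assert (H : forall k x, Cderive (fun x => expi (k * x)) x (Ci * RtoC k * expi (k * x))%C).
{ intros j x. apply (Cderive_expi (fun x => j * x)).
  eapply derive_eq. apply derive_scale, derive_id. ring. }
intros x. split.
- apply Cderive_plus; apply Cderive_cmul, H.
- eapply Cderive_eq. apply Cderive_plus; apply Cderive_cmul, Cderive_cmul, H.
  unfold Ci. rewrite (surjective_pairing a), (surjective_pairing b).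
  apply injective_projections; simpl; ring.
Qed.

(** The difference from the plane wave solves the same equation between c and x and has zero data at
    c. *)
Lemma Csolution_plane_extend q u u1 (k : R) (a b : C) (c x : R) :
  Csolution q u u1 ->
  (forall z, Rmin c x < z < Rmax c x -> q z = - k ^ 2) ->
  u c = plane k a b c ->
  u1 c = plane1 k a b c ->
  u x = plane k a b x /\
  u1 x = plane1 k a b x.
Proof.
intros Hs Hq H0 H1.
assert (Hp := Csolution_plane k a b).
set (p := plane k a b) in *. set (p1 := plane1 k a b) in *.
enough ((u x - p x)%C = RtoC 0 /\ (u1 x - p1 x)%C = RtoC 0) as [G0 G1].
{ split; [rewrite <- (Cplus_0_r (p x)), <- G0|rewrite <- (Cplus_0_r (p1 x)), <- G1]; ring. }
assert (HC : forall z, Ccontinuous (fun z => (u z - p z)%C) z /\ Ccontinuous (fun z => (u1 z - p1 z)%C) z).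
{ intros z. destruct (Csolution_continuous _ _ _ z Hs), (Csolution_continuous _ _ _ z Hp).
  split; now apply Ccontinuous_minus. }
assert (HD : forall z, Rmin c x < z < Rmax c x ->
  Cderive (fun z => (u z - p z)%C) z (u1 z - p1 z)%C /\
  Cderive (fun z => (u1 z - p1 z)%C) z (RtoC (q z) * (u z - p z))%C /\ Rabs (q z) <= k ^ 2).
{ intros z Hz. destruct (Hs z) as [S1 S2], (Hp z) as [P1 P2]. refine (conj _ (conj _ _)).
  - now apply Cderive_minus.
  - eapply Cderive_eq. apply Cderive_minus; eassumption. rewrite (Hq z Hz). ring.
  - rewrite (Hq z Hz), Rabs_Ropp, Rabs_pos_eq; [lra|apply pow2_ge_0]. }
destruct (Rle_dec c x) as [Hx|Hx].
- rewrite Rmin_left, Rmax_right in HD by lra.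
  apply (Code_unique q (k ^ 2) c x (fun z => (u z - p z)%C) (fun z => (u1 z - p1 z)%C)); auto.
  rewrite H0, H1. split; ring.
- rewrite Rmin_right, Rmax_left in HD by lra.
  apply (Code_unique q (k ^ 2) x c (fun z => (u z - p z)%C) (fun z => (u1 z - p1 z)%C)); auto; [lra|].
  rewrite H0, H1. split; ring.
Qed.

(** This is Im (conj u u'), the probability current; up to a constant factor it is the Wronskian of
    u and conj u, which both solve the equation because q is real. *)
Definition wronskian (u u1 : R -> C) (x : R) : R := fst (u x) * snd (u1 x) - snd (u x) * fst (u1 x).

Lemma wronskian_constant q u u1 x y : Csolution q u u1 -> wronskian u u1 x = wronskian u u1 y.
Proof.
intros Hs.
assert (HD : forall z, is_derive (wronskian u u1) z 0).
{ intros z. destruct (Hs z) as [[D1 D2] [D3 D4]]. eapply derive_eq.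
  apply derive_minus; apply derive_mult; first [exact D1|exact D2|exact D3|exact D4]. simpl. ring. }
assert (Hle : forall x y, x <= y -> wronskian u u1 y = wronskian u u1 x).
{ intros a b Hab. apply derive_zero_constant; auto. intros z _. eapply derive_continuous, HD. }
destruct (Rle_dec x y); [symmetry|]; apply Hle; lra.
Qed.

(** The cross terms of the two waves cancel in the current. Compared on both sides of the support,
    this yields |R|^2 + |T|^2 = 1. *)
Lemma wronskian_plane u u1 (k x : R) (a b : C) :
  u x = plane k a b x ->
  u1 x = plane1 k a b x ->
  wronskian u u1 x = k * (Cmod a ^ 2 - Cmod b ^ 2).
Proof.
intros H0 H1. unfold wronskian. rewrite H0, H1, !Cmod_sq. unfold plane, plane1.
replace (expi (- k * x)) with (cos (k * x), - sin (k * x)).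
2:{ unfold expi. replace (- k * x) with (- (k * x)) by ring. now rewrite cos_neg, sin_neg. }
unfold expi, Ci. simpl. assert (H := sin2_cos2 (k * x)). unfold Rsqr in H.
set (s := sin (k * x)) in *. set (c := cos (k * x)) in *.
replace (s * s) with (1 - c * c) by lra.
assert (Hs : s * s = 1 - c * c) by lra.
match goal with |- ?l = ?r => enough (l - r = 0) by lra end.
match goal with |- ?l = 0 => ring_simplify l end.
replace (s ^ 2) with (1 - c * c) by lra. ring.
Qed.

Lemma plane_coefficients (k : R) (a b a' b' : C) :
  k <> 0 -> plane k a b 0 = plane k a' b' 0 -> plane1 k a b 0 = plane1 k a' b' 0 ->
  a = a' /\ b = b'.
Proof.
intros Hk. unfold plane, plane1. rewrite !Rmult_0_r, expi_0, !Cmult_1_r. intros H0 H1.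
assert (H2 : (Ci * RtoC k * (a - b))%C = (Ci * RtoC k * (a' - b'))%C).
{ transitivity (a * (Ci * RtoC k) + b * (Ci * RtoC (- k)))%C; [rewrite RtoC_opp; ring|].
  rewrite H1, RtoC_opp. ring. }
assert (H3 : (a - b)%C = (a' - b')%C).
{ assert (HCi : (- Ci * Ci)%C = RtoC 1) by (apply injective_projections; simpl; ring).
  assert (Hk2 : (RtoC (/ k) * RtoC k)%C = RtoC 1) by (rewrite <- RtoC_mult, Rinv_l; auto).
  rewrite <- (Cmult_1_l (a - b)), <- (Cmult_1_l (a' - b')), <- HCi.
  rewrite <- (Cmult_1_l (- Ci * Ci * (a - b))), <- (Cmult_1_l (- Ci * Ci * (a' - b'))), <- Hk2.
  transitivity (RtoC (/ k) * (- Ci) * (Ci * RtoC k * (a - b)))%C; [ring|]. rewrite H2. ring. }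
injection H0 as Ha Hb. injection H3 as Hc Hd.
split; apply injective_projections; lra.
Qed.

Lemma is_schrodinger_solution V h u :
  0 < h ->
  (schrodinger_solution V h 1 u <->
   exists u1, Csolution (fun x => (V x - 1) / h ^ 2) u u1).
Proof.
intros Hh. assert (Hh2 : h ^ 2 <> 0) by (apply pow_nonzero; lra). split.
- intros [u1 [u2 [H1 [H2 H3]]]]. exists u1. intros x. split.
  + apply Cderive_iff, H1.
  + eapply Cderive_eq. apply Cderive_iff, H2. specialize (H3 x).
    injection H3 as Ha Hb. simpl in Ha, Hb.
    rewrite (surjective_pairing (u x)), (surjective_pairing (u2 x)).
    apply injective_projections; simpl; apply Rmult_eq_reg_l with (h ^ 2); auto;
      field_simplify; auto; lra.
- intros [u1 Hs]. exists u1, (fun x => (RtoC ((V x - 1) / h ^ 2) * u x)%C).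
  split; [|split].
  + intros x. apply Cderive_iff, Hs.
  + intros x. apply Cderive_iff, Hs.
  + intros x. rewrite (surjective_pairing (u x)).
    apply injective_projections; simpl; field; lra.
Qed.

Lemma plane_free_wave (h : R) (r : C) (x : R) :
  (expi (x / h) + r * expi (- x / h))%C = plane (/ h) (RtoC 1) r x.
Proof.
unfold plane. rewrite Cmult_1_l. unfold Rdiv. rewrite (Rmult_comm (/ h)).
replace (- / h * x) with (- x * / h) by ring. reflexivity.
Qed.

(** The outgoing form is assumed only beyond some point that may depend on h. Uniqueness carries it
    back to the bound [M] of the support, which depends on V alone. *)
Lemma scattering_solution_data V M h u r t :
  0 < h -> (forall x, M < Rabs x -> V x = 0) ->
  scattering_solution V h u r t ->
  exists u1, Csolution (fun x => (V x - 1) / h ^ 2) u u1 /\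
    (u 0 = plane (/ h) (RtoC 1) r 0 /\ u1 0 = plane1 (/ h) (RtoC 1) r 0) /\
    forall x, M <= x -> 0 <= x ->
      u x = plane (/ h) t (RtoC 0) x /\ u1 x = plane1 (/ h) t (RtoC 0) x.
Proof.
intros Hh HV [Hs [Hl [N Hr]]].
apply is_schrodinger_solution in Hs; auto. destruct Hs as [u1 Hs]. exists u1. split; auto.
assert (Hl' : forall x, x <= 0 -> u x = plane (/ h) (RtoC 1) r x).
{ intros x Hx. rewrite <- plane_free_wave. now apply Hl. }
assert (Hr' : forall x, N < x -> u x = plane (/ h) t (RtoC 0) x).
{ intros x Hx. rewrite Hr by auto. unfold plane, Rdiv. rewrite (Rmult_comm x). ring. }
split.
- split; [apply Hl'; lra|].
  apply (Cderive_unique_left u (plane (/ h) (RtoC 1) r) 0 1); try lra.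
  + intros y Hy; apply Hl'; lra.
  + apply Hs.
  + apply Csolution_plane.
- intros x Hx Hx0. set (c := Rmax x N + 1).
  assert (Hc1 : x < c) by (unfold c; generalize (Rmax_l x N); lra).
  assert (Hc2 : N < c) by (unfold c; generalize (Rmax_r x N); lra).
  apply (Csolution_plane_extend _ u u1 (/ h) t (RtoC 0) c x Hs).
  + intros z. rewrite Rmin_right, Rmax_left by lra. intros Hz.
    rewrite HV by (rewrite Rabs_pos_eq; lra). field. lra.
  + now apply Hr'.
  + apply (Cderive_unique_left u (plane (/ h) t (RtoC 0)) c (c - N)); try lra.
    * intros y Hy; apply Hr'; lra.
    * apply Hs.
    * apply Csolution_plane.
Qed.

(** Start from e^{ikx} at a point c beyond the support, continue it to the left of 0, and divide by
    the coefficient a of the incoming wave found there. Conservation of the current gives |a|^2 = 1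
    + |b|^2, so a is not 0. *)
Lemma scattering_exists_unique V M B h :
  0 < h -> (forall x, continuous V x) -> (forall x, Rabs (V x) <= B) ->
  (forall x, x <= 0 -> V x = 0) -> (forall x, M < Rabs x -> V x = 0) ->
  exists! u : R -> C, exists r t : C, scattering_solution V h u r t.
Proof.
intros Hh CV HB HV0 HVM.
set (q := fun x => (V x - 1) / h ^ 2). set (k := / h).
assert (Hk : 0 < k) by now apply Rinv_0_lt_compat.
assert (Hh2 : 0 < / h ^ 2) by (apply Rinv_0_lt_compat, pow_lt, Hh).
assert (Cq : forall x, continuous q x).
{ intros x. apply (continuous_Rmult (fun x => V x - 1) (fun _ => / h ^ 2));
    [apply continuous_Rminus; auto|]; apply continuous_const. }
assert (Hq : forall x, Rabs (q x) <= (B + 1) * / h ^ 2).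
{ intros x. unfold q, Rdiv. rewrite Rabs_mult, (Rabs_pos_eq (/ h ^ 2)) by lra.
  apply Rmult_le_compat_r; [lra|]. unfold Rminus.
  eapply Rle_trans; [apply Rabs_triang|]. rewrite Rabs_Ropp, Rabs_R1. specialize (HB x). lra. }
set (c := Rabs M + 1).
assert (Hc : M < c /\ 0 < c) by (unfold c; generalize (Rle_abs M) (Rabs_pos M); lra).
assert (Hqk : forall z, z <= 0 \/ c <= z -> q z = - k ^ 2).
{ intros z Hz. unfold q. replace (V z) with 0. unfold k; field; lra.
  symmetry. destruct Hz; [now apply HV0|apply HVM]. rewrite Rabs_pos_eq; lra. }
destruct (linear_ode_exists q _ c (cos (k * c)) (- k * sin (k * c)) Cq Hq) as [yr [zr [Hyr [Hzr Hdr]]]].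
destruct (linear_ode_exists q _ c (sin (k * c)) (k * cos (k * c)) Cq Hq) as [yi [zi [Hyi [Hzi Hdi]]]].
set (U := fun x => (yr x, yi x)). set (U1 := fun x => (zr x, zi x)).
assert (HU : Csolution q U U1).
{ intros x. destruct (Hdr x), (Hdi x). split; split; simpl; auto.
  - eapply derive_eq; [eassumption|ring].
  - eapply derive_eq; [eassumption|ring]. }
assert (HUc : U c = plane k (RtoC 1) (RtoC 0) c /\ U1 c = plane1 k (RtoC 1) (RtoC 0) c).
{ unfold U, U1, plane, plane1. rewrite Hyr, Hyi, Hzr, Hzi. unfold expi, Ci.
  split; apply injective_projections; simpl; ring. }
destruct HUc as [HUc HU1c].
(* These solve U(0) = a + b, U'(0) = i (a - b) / h. *)
set (a := (RtoC (/ 2) * (U 0%R - Ci * RtoC h * U1 0%R))%C).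
set (b := (RtoC (/ 2) * (U 0%R + Ci * RtoC h * U1 0%R))%C).
assert (HU0 : U 0 = plane k a b 0 /\ U1 0 = plane1 k a b 0).
{ unfold plane, plane1. rewrite !Rmult_0_r, expi_0. unfold a, b, Ci, k.
  rewrite (surjective_pairing (U 0)), (surjective_pairing (U1 0)).
  split; apply injective_projections; simpl; field; lra. }
destruct HU0 as [HU0 HU10].
assert (Ha : a <> RtoC 0).
{ intros Ha.
  assert (H := wronskian_constant q U U1 c 0 HU).
  rewrite (wronskian_plane U U1 k c _ _ HUc HU1c), (wronskian_plane U U1 k 0 _ _ HU0 HU10) in H.
  apply Rmult_eq_reg_l in H; [|lra].
  rewrite Ha, Cmod_1, Cmod_0 in H. generalize (pow2_ge_0 (Cmod b)). lra. }
set (u := fun x => (/ a * U x + RtoC 0 * U x)%C).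
assert (Hu : Csolution q u (fun x => (/ a * U1 x + RtoC 0 * U1 x)%C)) by now apply Csolution_combination.
assert (Hu' : scattering_solution V h u (b / a)%C (/ a)%C).
{ split; [|split].
+ apply is_schrodinger_solution; eauto.
+ intros x Hx. rewrite plane_free_wave. fold k.
  destruct (Csolution_plane_extend q U U1 k a b 0 x HU) as [HUx _]; auto.
  { intros z. rewrite Rmin_right, Rmax_left by lra. intros Hz. apply Hqk. lra. }
  unfold u. rewrite HUx. unfold plane. field. exact Ha.
+ exists c. intros x Hx.
  destruct (Csolution_plane_extend q U U1 k (RtoC 1) (RtoC 0) c x HU) as [HUx _]; auto.
  { intros z. rewrite Rmin_left, Rmax_right by lra. intros Hz. apply Hqk. lra. }
  unfold u. rewrite HUx. unfold plane, Rdiv. fold k. rewrite (Rmult_comm x k). ring. }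
exists u. split.
- exists (b / a)%C, (/ a)%C. exact Hu'.
- intros v [r [t Hv]].
  destruct (scattering_solution_data V M h v r t Hh HVM Hv) as [v1 [Sv [[Hv0 Hv10] Hvr]]].
  destruct (scattering_solution_data V M h u _ _ Hh HVM Hu') as [u1 [Su [[Hu0 Hu10] Hur]]].
  destruct (Hvr c) as [Hvc Hv1c]; try lra. destruct (Hur c) as [Huc Hu1c]; try lra.
  (* Both u and v are outgoing at c, with transmission coefficients 1/a and t. Hence t u - v / a has
     zero data at c and vanishes everywhere; comparing the incoming coefficients at 0 gives t = 1/a,
     and then u = v. *)
  assert (Hz := Csolution_combination q u u1 v v1 t (- / a)%C Su Sv).
  assert (Hzero := fun x => Csolution_zero q _ _ _ c Hq Hz
    ltac:(cbv beta; rewrite Huc, Hvc; unfold plane; ring)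
    ltac:(cbv beta; rewrite Hu1c, Hv1c; unfold plane1; ring) x).
  assert (Ht : t = (/ a)%C).
  { destruct (Hzero 0) as [Z0 Z1]. rewrite Hu0, Hv0 in Z0. rewrite Hu10, Hv10 in Z1.
    destruct (plane_coefficients k t (t * (b / a))%C (/ a)%C (/ a * r)%C) as [Ht _]; auto; [lra| |].
    - fold k in Z0. unfold plane in *.
      apply (f_equal (fun z => Cplus z (/ a * expi (k * 0) + / a * r * expi (- k * 0)))%C) in Z0.
      rewrite Cplus_0_l in Z0. rewrite <- Z0. ring.
    - fold k in Z1. unfold plane1 in *.
      apply (f_equal (fun z => Cplus z (/ a * (Ci * RtoC k * expi (k * 0)) + / a * r * (Ci * RtoC (- k) * expi (- k * 0))))%C) in Z1.
      rewrite Cplus_0_l in Z1. rewrite <- Z1. ring. }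
  apply functional_extensionality. intros x. destruct (Hzero x) as [Zx _].
  rewrite Ht in Zx.
  assert (Hx : (a * (/ a * u x + - / a * v x))%C = (u x - v x)%C) by (field; exact Ha).
  rewrite Zx, Cmult_0_r in Hx. rewrite <- (Cplus_0_l (v x)), Hx. ring.
Qed.

(** * Estimates for the WKB amplitudes *)

(* Data of the WKB transformation on the half line: [p] is the momentum, [phi] its primitive,
   [g = p' / (2 p)] the coupling between the two WKB modes, and [k = g / p]. *)
Record wkb_profile (al M x1 K : R) (p phi g k k1 : R -> R) : Prop := {
  wkb_al : 0 < al < 1;
  wkb_M : 0 < M;
  wkb_x1 : 0 < x1 <= M;
  wkb_K : 0 <= K;
  wkb_phi_continuous : forall x, continuous phi x;
  wkb_phi : forall x, 0 < x -> is_derive phi x (p x);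
  wkb_k : forall x, 0 < x -> is_derive k x (k1 x);
  wkb_gkp : forall x, 0 < x -> g x = k x * p x;
  wkb_kM : k M = 0;
  wkb_g_bound : forall x, 0 < x <= M -> Rabs (g x) <= K * Rpower x (al - 1);
  wkb_k_bound : forall x, 0 < x <= M -> Rabs (k x) <= K * Rpower x (al - 1);
  wkb_k1_bound : forall x, 0 < x <= M -> Rabs (k1 x) <= K * Rpower x (al - 1 - 1);
  wkb_g_singular : forall x, 0 < x < x1 ->
    Rabs (g x + / 4 * al * Rpower x (al - 1)) <= K * Rpower x (2 * al - 1);
  wkb_phi_singular : forall x, 0 < x < x1 -> Rabs (phi x - x) <= K * Rpower x (1 + al) }.

(* The WKB amplitudes [a] (right-moving) and [b] (left-moving), with [eta = h / 2]. *)
Record wkb_amplitudes (M eta : R) (phi g : R -> R) (a b : R -> C) : Prop := {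
  amp_eta : 0 < eta;
  amp_continuous : forall x, Ccontinuous a x /\ Ccontinuous b x;
  amp_a : forall x, 0 < x -> Cderive a x (RtoC (g x) * expi (- / eta * phi x) * b x)%C;
  amp_b : forall x, 0 < x -> Cderive b x (RtoC (g x) * expi (/ eta * phi x) * a x)%C;
  amp_a0 : a 0 = RtoC 1;
  amp_b0 : Cmod (b 0) <= 1;
  amp_bM : b M = RtoC 0 }.

(** Gronwall for E = |a|^2 + |b|^2. The two coupling phases are conjugate, so a and b contribute
    equally to E' and |E'| <= 2 |g| E. The rate 2 K x^{alpha - 1} has the continuous primitive (2 K
    / alpha) x^alpha, and the phases have modulus one, so the bound does not depend on eta. *)
Lemma wkb_energy al M x1 K p phi g k k1 eta a b :
  wkb_profile al M x1 K p phi g k k1 -> wkb_amplitudes M eta phi g a b ->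
  forall x, 0 <= x <= M ->
    Cmod (a x) <= 2 * exp (K / al * Rpower M al) /\ Cmod (b x) <= 2 * exp (K / al * Rpower M al).
Proof.
intros HP HA x Hx.
assert (Hal := wkb_al _ _ _ _ _ _ _ _ _ HP). assert (HM := wkb_M _ _ _ _ _ _ _ _ _ HP).
assert (HK := wkb_K _ _ _ _ _ _ _ _ _ HP).
set (E := fun x => fst (a x) * fst (a x) + snd (a x) * snd (a x)
                   + (fst (b x) * fst (b x) + snd (b x) * snd (b x))).
assert (HE : forall x, E x = Cmod (a x) ^ 2 + Cmod (b x) ^ 2).
{ intros z. unfold E. rewrite !Cmod_sq. ring. }
destruct (gronwall E
  (fun x => 4 * g x * (fst (a x) * fst (expi (- / eta * phi x) * b x)%C
                       + snd (a x) * snd (expi (- / eta * phi x) * b x)%C))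
  (fun x => 2 * (K / al) * pos_part_pow al x)
  (fun x => 2 * (K / al) * (al * Rpower x (al - 1))) 0 x) as [H _].
- lra.
- intros z Hz. destruct (amp_continuous _ _ _ _ _ _ HA z) as [[C1 C2] [C3 C4]]. split.
  + apply continuous_Rplus; apply continuous_Rplus; now apply continuous_Rmult.
  + apply continuous_Rmult; [apply continuous_const|]. apply continuous_pos_part_pow; lra.
- intros z Hz.
  destruct (amp_a _ _ _ _ _ _ HA z) as [D1 D2]; [lra|].
  destruct (amp_b _ _ _ _ _ _ HA z) as [D3 D4]; [lra|].
  refine (conj _ (conj (derive_scale _ _ _ _ (derive_pos_part_pow al z (proj1 Hz))) _)).
  + eapply derive_eq. apply derive_plus; apply derive_plus; apply derive_mult;
      first [exact D1|exact D2|exact D3|exact D4].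
    simpl. replace (- / eta * phi z) with (- (/ eta * phi z)) by ring.
    rewrite cos_neg, sin_neg. ring.
  + assert (Hdot := Cdot_le_Cmod (a z) (expi (- / eta * phi z) * b z)).
    rewrite Cmod_mult, Cmod_expi, Rmult_1_l in Hdot.
    assert (Hg := wkb_g_bound _ _ _ _ _ _ _ _ _ HP z ltac:(lra)).
    rewrite !Rabs_mult, (Rabs_pos_eq 4) by lra. rewrite HE.
    set (d := Rabs (fst (a z) * _ + _)) in *.
    assert (Hd : 2 * d <= Cmod (a z) ^ 2 + Cmod (b z) ^ 2).
    { assert (Hs := pow2_ge_0 (Cmod (a z) - Cmod (b z))). nra. }
    assert (Hd0 : 0 <= d) by apply Rabs_pos.
    assert (Hg0 := Rabs_pos (g z)).
    replace (2 * (K / al) * (al * Rpower z (al - 1))) with (2 * (K * Rpower z (al - 1))) by (field; lra).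
    nra.
- rewrite (pos_part_pow_npos al 0), Rmult_0_r, Rminus_0_r in H by lra.
  assert (HE0 : E 0 <= 2).
  { rewrite HE, (amp_a0 _ _ _ _ _ _ HA), Cmod_1.
    assert (H0 := amp_b0 _ _ _ _ _ _ HA). assert (H1 := Cmod_ge_0 (b 0)). nra. }
  set (e := exp (K / al * Rpower M al)).
  assert (Hka : 0 <= K / al) by (apply Rdiv_le_0_compat; lra).
  assert (Hexp : exp (2 * (K / al) * pos_part_pow al x) <= e * e).
  { unfold e. rewrite <- exp_plus. apply exp_le.
    assert (pos_part_pow al x <= Rpower M al).
    { unfold pos_part_pow. destruct (Rlt_dec 0 x); [apply Rle_Rpower_l; lra|left; apply Rpower_pos]. }
    nra. }
  assert (He : 0 < e) by apply exp_pos.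
  assert (Hexp0 := exp_pos (2 * (K / al) * pos_part_pow al x)).
  assert (HEx : E x <= 4 * (e * e)).
  { eapply Rle_trans; [apply H|]. nra. }
  rewrite HE in HEx.
  assert (Ha := Cmod_ge_0 (a x)). assert (Hb := Cmod_ge_0 (b x)).
  split; apply Rsqr_incr_0_var; unfold Rsqr; nra.
Qed.

(** Integrating from x to [M], where b and k vanish, leaves the boundary term at x and two
    integrals, with k' and with a'. In the second one the phases of a' and of the weight cancel, so
    it no longer oscillates, but the factor eta has already been gained. *)
Lemma wkb_left_mover_bound al M x1 K p phi g k k1 eta a b D :
  wkb_profile al M x1 K p phi g k k1 -> wkb_amplitudes M eta phi g a b ->
  (forall x, 0 <= x <= M -> Cmod (a x) <= D /\ Cmod (b x) <= D) ->
  forall x, 0 < x <= M ->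
    Cmod (b x) <= D * ((K + K * K * Rpower M al) / (1 - al) + K) * (eta * Rpower x (al - 1)).
Proof.
intros HP HA HD x Hx.
assert (Hal := wkb_al _ _ _ _ _ _ _ _ _ HP). assert (HM := wkb_M _ _ _ _ _ _ _ _ _ HP).
assert (HK := wkb_K _ _ _ _ _ _ _ _ _ HP). assert (Heta := amp_eta _ _ _ _ _ _ HA).
assert (HD0 : 0 <= D) by (eapply Rle_trans; [apply Cmod_ge_0|apply (HD 0); lra]).
(* One integration by parts against the oscillating phase. *)
set (F := fun z => (b z + Ci * RtoC eta * (RtoC (k z) * (a z * expi (/ eta * phi z))))%C).
set (F' := fun z => (Ci * RtoC eta * (RtoC (k1 z) * (a z * expi (/ eta * phi z))
   + RtoC (k z * g z) * b z))%C).
set (K3 := D * (K + K * K * Rpower M al)).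
set (W := fun z => - (eta * K3 / (1 - al)) * Rpower z (al - 1)).
assert (DW : forall z, 0 < z -> is_derive W z (eta * K3 * Rpower z (al - 1 - 1))).
{ intros z Hz. eapply derive_eq. apply derive_scale, derive_Rpower, Hz. field. lra. }
assert (DF : forall z, 0 < z -> Cderive F z (F' z)).
{ intros z Hz. eapply Cderive_eq.
  - apply Cderive_plus; [apply (amp_b _ _ _ _ _ _ HA z Hz)|].
    apply Cderive_cmul, Cderive_mult.
    + apply Cderive_RtoC, (wkb_k _ _ _ _ _ _ _ _ _ HP z Hz).
    + apply Cderive_mult; [apply (amp_a _ _ _ _ _ _ HA z Hz)|].
      apply (Cderive_expi (fun z => / eta * phi z)), derive_scale, (wkb_phi _ _ _ _ _ _ _ _ _ HP z Hz).
  - unfold F'. rewrite (wkb_gkp _ _ _ _ _ _ _ _ _ HP z Hz).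
    replace (- / eta * phi z) with (- (/ eta * phi z)) by ring.
    assert (Hi : (Ci * Ci)%C = RtoC (-1)) by (apply injective_projections; simpl; ring).
    assert (He : (expi (/ eta * phi z) * expi (- (/ eta * phi z)))%C = RtoC 1) by apply expi_opp.
    set (e := expi (/ eta * phi z)) in *. set (e' := expi (- (/ eta * phi z))) in *.
    assert (Hee : (RtoC eta * RtoC (/ eta))%C = RtoC 1) by (rewrite <- RtoC_mult, Rinv_r; [auto|lra]).
    rewrite !RtoC_mult.
    transitivity (RtoC (k z) * RtoC (p z) * e * a z
      + (Ci * Ci) * (RtoC eta * RtoC (/ eta)) * (RtoC (k z) * RtoC (p z) * e * a z)
      + Ci * RtoC eta * (RtoC (k1 z) * (a z * e)
         + RtoC (k z) * (RtoC (k z) * RtoC (p z)) * b z * (e * e')))%C; [ring|].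
    rewrite Hi, Hee, He. replace (RtoC (-1)) with (- RtoC 1)%C by (apply injective_projections; simpl; ring).
    ring. }
assert (HFx : Cmod (F M - F x)%C <= W M - W x).
{ apply (Cmean_value F F' W (fun z => eta * K3 * Rpower z (al - 1 - 1))); [lra| |].
  - intros z Hz. split; [eapply Cderive_continuous, DF; lra|eapply derive_continuous, DW; lra].
  - intros z Hz. refine (conj (DF z ltac:(lra)) (conj (DW z ltac:(lra)) _)).
    unfold F'. rewrite !Cmod_mult, Cmod_R, (Rabs_pos_eq eta) by lra.
    rewrite Cmod_Ci, Rmult_1_l, Rmult_assoc. apply Rmult_le_compat_l; [lra|].
    eapply Rle_trans; [apply Cmod_triangle|].
    rewrite !Cmod_mult, !Cmod_R, Cmod_expi, Rmult_1_r, Rabs_mult.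
    destruct (HD z ltac:(lra)) as [Ha Hb].
    assert (H1 := wkb_k1_bound _ _ _ _ _ _ _ _ _ HP z ltac:(lra)).
    assert (H2 := wkb_k_bound _ _ _ _ _ _ _ _ _ HP z ltac:(lra)).
    assert (H3 := wkb_g_bound _ _ _ _ _ _ _ _ _ HP z ltac:(lra)).
    assert (G1 := Rabs_pos (k1 z)). assert (G2 := Rabs_pos (k z)). assert (G3 := Rabs_pos (g z)).
    assert (Ha0 := Cmod_ge_0 (a z)). assert (Hb0 := Cmod_ge_0 (b z)).
    (* The product k g is of order z^{2 alpha - 2}, less singular than the z^{alpha - 2} of k'; on
       (0, M] it is absorbed at the cost of M^alpha. *)
    assert (Hpp : Rpower z (al - 1) * Rpower z (al - 1) <= Rpower M al * Rpower z (al - 1 - 1)).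
    { rewrite <- Rpower_plus. replace (al - 1 + (al - 1)) with (al + (al - 1 - 1)) by ring.
      rewrite Rpower_plus. apply Rmult_le_compat_r; [left; apply Rpower_pos|].
      apply Rle_Rpower_l; lra. }
    assert (T1 : Rabs (k1 z) * Cmod (a z) <= K * Rpower z (al - 1 - 1) * D)
      by (apply Rmult_le_compat; auto).
    assert (T2 : Rabs (k z) * Rabs (g z) <= K * Rpower z (al - 1) * (K * Rpower z (al - 1)))
      by (apply Rmult_le_compat; auto).
    assert (T3 : Rabs (k z) * Rabs (g z) * Cmod (b z) <= K * Rpower z (al - 1) * (K * Rpower z (al - 1)) * D)
      by (apply Rmult_le_compat; auto; apply Rmult_le_pos; auto).
    assert (T4 : K * Rpower z (al - 1) * (K * Rpower z (al - 1)) * D <= K * K * D * (Rpower M al * Rpower z (al - 1 - 1))).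
    { replace (K * Rpower z (al - 1) * (K * Rpower z (al - 1)) * D)
        with (K * K * D * (Rpower z (al - 1) * Rpower z (al - 1))) by ring.
      apply Rmult_le_compat_l; auto. apply Rmult_le_pos; auto. apply Rmult_le_pos; auto. }
    unfold K3. lra. }
assert (HFM : F M = RtoC 0).
{ unfold F. rewrite (amp_bM _ _ _ _ _ _ HA), (wkb_kM _ _ _ _ _ _ _ _ _ HP). ring. }
assert (HWM : W M <= 0).
{ unfold W. assert (0 <= eta * K3 / (1 - al) * Rpower M (al - 1)); [|lra].
  apply Rmult_le_pos; [|left; apply Rpower_pos]. apply Rdiv_le_0_compat; [|lra].
  apply Rmult_le_pos; [lra|]. unfold K3. apply Rmult_le_pos; auto.
  assert (0 < Rpower M al) by apply Rpower_pos. assert (0 <= K * K) by (apply Rmult_le_pos; auto). nra. }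
replace (b x) with (- (F M - F x) - Ci * RtoC eta * (RtoC (k x) * (a x * expi (/ eta * phi x))))%C.
2:{ rewrite HFM. unfold F. ring. }
eapply Rle_trans; [apply Cmod_triangle|].
rewrite !Cmod_opp, !Cmod_mult, !Cmod_R, Cmod_expi, Rmult_1_r, (Rabs_pos_eq eta) by lra.
rewrite Cmod_Ci, Rmult_1_l.
assert (H2 := wkb_k_bound _ _ _ _ _ _ _ _ _ HP x Hx).
destruct (HD x ltac:(lra)) as [Ha _].
assert (T : Rabs (k x) * Cmod (a x) <= K * Rpower x (al - 1) * D)
  by (apply Rmult_le_compat; auto; [apply Rabs_pos|apply Cmod_ge_0]).
assert (T' : eta * (Rabs (k x) * Cmod (a x)) <= eta * (K * Rpower x (al - 1) * D))
  by (apply Rmult_le_compat_l; lra).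
assert (HWx : - W x = D * ((K + K * K * Rpower M al) / (1 - al)) * (eta * Rpower x (al - 1))).
{ unfold W, K3. field. lra. }
lra.
Qed.

Lemma rot_int_upper (b L : R) :
  0 < b -> Cderive (fun L => rot_int b (PI / 2) L) L (expi (pos_part_pow b L)).
Proof.
intros Hb. split; cbn [rot_int fst snd expi].
- eapply derive_eq. apply derive_RInt_upper. intros y. now apply continuous_rot.
  unfold rot_re. rewrite cos_PI2, sin_PI2, Ropp_0, Rmult_0_l, exp_0, !Rmult_1_l. reflexivity.
- eapply derive_eq. apply derive_RInt_upper. intros y. now apply continuous_rot.
  unfold rot_im. rewrite cos_PI2, sin_PI2, Ropp_0, Rmult_0_l, exp_0, !Rmult_1_l. reflexivity.
Qed.

Lemma Rpower_scale (eta x c : R) :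
  0 < eta -> 0 < x -> Rpower eta c * Rpower (/ eta * x) c = Rpower x c.
Proof.
intros He Hx. assert (0 < / eta) by now apply Rinv_0_lt_compat.
rewrite Rpower_mult_distr by (auto; nra). f_equal. field. lra.
Qed.

(** [H] adds to b a primitive of (alpha / 4) x^{alpha - 1} e^{i x / eta}, the opposite of the model
    source. In the variable s = (x / eta)^alpha this primitive is an integral of the bounded
    function e^{i s^{1/alpha}}. What is left in [H'] is only the error of the model. *)
Lemma wkb_near_origin al M x1 K p phi g k k1 eta a b D :
  wkb_profile al M x1 K p phi g k k1 -> wkb_amplitudes M eta phi g a b ->
  (forall x, 0 <= x <= M -> Cmod (a x) <= D /\ Cmod (b x) <= D) ->
  forall y, 0 < y < x1 ->
    Cmod (b y + RtoC (/ 4 * Rpower eta al) * rot_int (/ al) (PI / 2) (Rpower (/ eta * y) al) - b 0%R)%C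
     <= (K * (K * D / al) + K) / (2 * al) * Rpower y (2 * al)
        + / eta * (K / (2 * al + 1)) * Rpower y (2 * al + 1).
Proof.
intros HP HA HD y Hy.
assert (Hal := wkb_al _ _ _ _ _ _ _ _ _ HP). assert (HM := wkb_M _ _ _ _ _ _ _ _ _ HP).
assert (HK := wkb_K _ _ _ _ _ _ _ _ _ HP). assert (Heta := amp_eta _ _ _ _ _ _ HA).
assert (Hx1 := wkb_x1 _ _ _ _ _ _ _ _ _ HP).
assert (Hieta : 0 < / eta) by now apply Rinv_0_lt_compat.
assert (HD0 : 0 <= D) by (eapply Rle_trans; [apply Cmod_ge_0|apply (HD 0); lra]).
assert (Hial : 0 < / al) by (apply Rinv_0_lt_compat; lra).
assert (Ha1 : forall x, 0 < x < x1 -> Cmod (a x - RtoC 1)%C <= K * D / al * Rpower x al).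
{ intros x Hx. rewrite <- (amp_a0 _ _ _ _ _ _ HA).
  replace (K * D / al * Rpower x al) with (K * D / al * pos_part_pow al x - K * D / al * pos_part_pow al 0)
    by (rewrite (pos_part_pow_npos al 0), pos_part_pow_pos by lra; ring).
  apply (Cmean_value a (fun x => RtoC (g x) * expi (- / eta * phi x) * b x)%C
    (fun x => K * D / al * pos_part_pow al x) (fun x => K * D / al * (al * Rpower x (al - 1)))); [lra| |].
  - intros z Hz. split; [apply (amp_continuous _ _ _ _ _ _ HA)|].
    apply continuous_Rmult; [apply continuous_const|apply continuous_pos_part_pow; lra].
  - intros z Hz. refine (conj (amp_a _ _ _ _ _ _ HA z (proj1 Hz))
      (conj (derive_scale _ _ _ _ (derive_pos_part_pow al z (proj1 Hz))) _)).
    rewrite !Cmod_mult, Cmod_R, Cmod_expi, Rmult_1_r.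
    replace (K * D / al * (al * Rpower z (al - 1))) with (K * Rpower z (al - 1) * D) by (field; lra).
    apply Rmult_le_compat; [apply Rabs_pos|apply Cmod_ge_0| |apply HD; lra].
    apply (wkb_g_bound _ _ _ _ _ _ _ _ _ HP); lra. }
set (H := fun x => (b x + RtoC (/ 4 * Rpower eta al) * rot_int (/ al) (PI / 2) (pos_part_pow al (/ eta * x)))%C).
set (H' := fun x => (RtoC (g x) * expi (/ eta * phi x) * a x
   + RtoC (/ 4 * al * Rpower x (al - 1)) * expi (/ eta * x))%C).
set (W := fun x => (K * (K * D / al) + K) / (2 * al) * pos_part_pow (2 * al) x
   + / eta * (K / (2 * al + 1)) * pos_part_pow (2 * al + 1) x).
set (w := fun x => (K * (K * D / al) + K) * Rpower x (2 * al - 1) + / eta * K * Rpower x (2 * al)).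
assert (HW : W y - W 0 = (K * (K * D / al) + K) / (2 * al) * Rpower y (2 * al)
        + / eta * (K / (2 * al + 1)) * Rpower y (2 * al + 1)).
{ unfold W. rewrite (pos_part_pow_npos _ 0), (pos_part_pow_npos _ 0), !pos_part_pow_pos by lra. ring. }
replace (b y + RtoC (/ 4 * Rpower eta al) * rot_int (/ al) (PI / 2) (Rpower (/ eta * y) al) - b 0%R)%C
  with (H y - H 0%R)%C.
2:{ unfold H. rewrite Rmult_0_r, (pos_part_pow_npos al 0), pos_part_pow_pos by (try nra; lra).
    unfold rot_int at 2. rewrite !RInt_same. apply injective_projections; simpl; ring. }
rewrite <- HW.
assert (Cscale : forall z, continuous (fun x => / eta * x) z).
{ intros z. eapply derive_continuous, derive_scale, derive_id. }
apply (Cmean_value H H' W w); [lra| |].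
- intros z Hz. split.
  + apply Ccontinuous_plus; [apply (amp_continuous _ _ _ _ _ _ HA)|].
    apply Ccontinuous_mult; [apply Ccontinuous_const|].
    destruct (Cderive_continuous _ _ _ (rot_int_upper (/ al) (pos_part_pow al (/ eta * z)) Hial)) as [R1 R2].
    assert (Cp : continuous (fun x => pos_part_pow al (/ eta * x)) z).
    { apply (continuous_comp (fun x => / eta * x) (pos_part_pow al)); auto.
      apply continuous_pos_part_pow; lra. }
    split.
    * exact (continuous_comp (fun x => pos_part_pow al (/ eta * x))
        (fun L => fst (rot_int (/ al) (PI / 2) L)) z Cp R1).
    * exact (continuous_comp (fun x => pos_part_pow al (/ eta * x))
        (fun L => snd (rot_int (/ al) (PI / 2) L)) z Cp R2).
  + apply continuous_Rplus; (apply continuous_Rmult; [apply continuous_const|apply continuous_pos_part_pow; lra]).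
- intros z Hz. assert (Hez : 0 < / eta * z) by nra. refine (conj _ (conj _ _)).
  + eapply Cderive_eq.
    * apply Cderive_plus; [apply (amp_b _ _ _ _ _ _ HA z (proj1 Hz))|]. apply Cderive_cmul.
      (* Chain rule for s = (x / eta)^alpha: s^{1/alpha} becomes x / eta again, and ds/dx restores
         the singular factor. *)
      instantiate (1 := (RtoC (/ eta * (al * Rpower (/ eta * z) (al - 1))) * expi (/ eta * z))%C).
      assert (Dp : is_derive (fun x => pos_part_pow al (/ eta * x)) z
        (/ eta * (al * Rpower (/ eta * z) (al - 1)))).
      { apply (derive_comp (pos_part_pow al) (fun x => / eta * x)).
        now apply derive_pos_part_pow.
        eapply derive_eq. apply derive_scale, derive_id. ring. }
      destruct (rot_int_upper (/ al) (pos_part_pow al (/ eta * z)) Hial) as [R1 R2].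
      replace (pos_part_pow (/ al) (pos_part_pow al (/ eta * z))) with (/ eta * z) in R1, R2.
      2:{ rewrite (pos_part_pow_pos al) by auto. rewrite pos_part_pow_pos by apply Rpower_pos.
          rewrite Rpower_mult, Rinv_r, Rpower_1; lra. }
      split.
      { eapply derive_eq. exact (derive_comp (fun L => fst (rot_int (/ al) (PI / 2) L))
          (fun x => pos_part_pow al (/ eta * x)) z _ _ R1 Dp). simpl; ring. }
      { eapply derive_eq. exact (derive_comp (fun L => snd (rot_int (/ al) (PI / 2) L))
          (fun x => pos_part_pow al (/ eta * x)) z _ _ R2 Dp). simpl; ring. }
    * unfold H'. rewrite Cmult_assoc, <- RtoC_mult. do 3 f_equal.
      rewrite <- (Rpower_scale eta z (al - 1)) by lra.
      assert (Hee : Rpower eta (al - 1) = Rpower eta al * / eta).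
      { unfold Rminus. rewrite Rpower_plus, Rpower_Ropp, Rpower_1; auto. }
      rewrite Hee. ring.
  + assert (D1 := derive_scale _ ((K * (K * D / al) + K) / (2 * al)) z _ (derive_pos_part_pow (2 * al) z (proj1 Hz))).
    assert (D2 := derive_scale _ (/ eta * (K / (2 * al + 1))) z _ (derive_pos_part_pow (2 * al + 1) z (proj1 Hz))).
    eapply derive_eq. exact (derive_plus _ _ _ _ _ D1 D2).
    unfold w. replace (2 * al + 1 - 1) with (2 * al) by ring. field. lra.
  (* One summand per replacement: a by 1, g by its singular part, phi by x. They are of order z^{2
     alpha - 1}, z^{2 alpha - 1} and z^{2 alpha} / eta. *)
  + assert (HH : H' z = (RtoC (g z) * expi (/ eta * phi z) * (a z - RtoC 1)
      + RtoC (g z + / 4 * al * Rpower z (al - 1)) * expi (/ eta * phi z)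
      + RtoC (/ 4 * al * Rpower z (al - 1)) * (expi (/ eta * z) - expi (/ eta * phi z)))%C).
    { unfold H'. rewrite RtoC_plus. ring. }
    rewrite HH. unfold w.
    assert (Hr0 := Rpower_pos z (al - 1)).
    assert (B1 : Cmod (RtoC (g z) * expi (/ eta * phi z) * (a z - RtoC 1))%C
      <= K * (K * D / al) * Rpower z (2 * al - 1)).
    { rewrite !Cmod_mult, Cmod_R, Cmod_expi, Rmult_1_r.
      replace (2 * al - 1) with ((al - 1) + al) by ring. rewrite Rpower_plus.
      replace (K * (K * D / al) * (Rpower z (al - 1) * Rpower z al))
        with (K * Rpower z (al - 1) * (K * D / al * Rpower z al)) by ring.
      apply Rmult_le_compat; [apply Rabs_pos|apply Cmod_ge_0| |apply Ha1; lra].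
      apply (wkb_g_bound _ _ _ _ _ _ _ _ _ HP); lra. }
    assert (B2 : Cmod (RtoC (g z + / 4 * al * Rpower z (al - 1)) * expi (/ eta * phi z))%C
      <= K * Rpower z (2 * al - 1)).
    { rewrite Cmod_mult, Cmod_R, Cmod_expi, Rmult_1_r.
      apply (wkb_g_singular _ _ _ _ _ _ _ _ _ HP); lra. }
    assert (B3 : Cmod (RtoC (/ 4 * al * Rpower z (al - 1)) * (expi (/ eta * z) - expi (/ eta * phi z)))%C
      <= / eta * K * Rpower z (2 * al)).
    { rewrite Cmod_mult, Cmod_R.
      assert (Hq : 0 <= / 4 * al * Rpower z (al - 1)) by nra.
      rewrite (Rabs_pos_eq _ Hq).
      assert (Hl : Cmod (expi (/ eta * z) - expi (/ eta * phi z))%C <= / eta * (K * Rpower z (1 + al))).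
      { eapply Rle_trans; [apply expi_lipschitz|].
        rewrite <- Rmult_minus_distr_l, Rabs_mult, (Rabs_pos_eq (/ eta)) by lra.
        apply Rmult_le_compat_l; [lra|]. rewrite Rabs_minus_sym.
        apply (wkb_phi_singular _ _ _ _ _ _ _ _ _ HP); lra. }
      replace (2 * al) with ((al - 1) + (1 + al)) by ring. rewrite Rpower_plus.
      assert (Hr1 := Rpower_pos z (1 + al)).
      apply Rle_trans with (Rpower z (al - 1) * (/ eta * (K * Rpower z (1 + al)))).
      - apply Rmult_le_compat; auto; [apply Cmod_ge_0|]. nra.
      - right; ring. }
    eapply Rle_trans; [apply Cmod_triangle|].
    eapply Rle_trans; [apply Rplus_le_compat_r, Cmod_triangle|]. lra.
Qed.

(** Matching at y = L eta. There the far bound eta y^{alpha - 1} equals eta^alpha L^{alpha - 1},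
    while y^{2 alpha} and y^{2 alpha + 1} / eta are eta^{2 alpha} times powers of L. The constant
    [B] depends on neither L nor eta, which allows L to be fixed before eta tends to 0. *)
Lemma wkb_reflection al M x1 K p phi g k k1 :
  wkb_profile al M x1 K p phi g k k1 ->
  exists B, 0 <= B /\ forall eta a b, wkb_amplitudes M eta phi g a b ->
    forall L, 0 < L -> L * eta < x1 ->
    Cmod (b 0%R - RtoC (/ 4 * Rpower eta al) * rot_int (/ al) (PI / 2) (Rpower L al))%C
     <= Rpower eta al * (B * (Rpower L (al - 1) + (Rpower L (2 * al) + Rpower L (2 * al + 1)) * Rpower eta al)).
Proof.
intros HP.
assert (Hal := wkb_al _ _ _ _ _ _ _ _ _ HP). assert (HM := wkb_M _ _ _ _ _ _ _ _ _ HP).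
assert (HK := wkb_K _ _ _ _ _ _ _ _ _ HP). assert (Hx1 := wkb_x1 _ _ _ _ _ _ _ _ _ HP).
set (D := 2 * exp (K / al * Rpower M al)).
assert (HD0 : 0 <= D) by (unfold D; generalize (exp_pos (K / al * Rpower M al)); lra).
set (C1 := D * ((K + K * K * Rpower M al) / (1 - al) + K)).
set (C2 := (K * (K * D / al) + K) / (2 * al)). set (C3 := K / (2 * al + 1)).
assert (HKK : 0 <= K * K) by (apply Rmult_le_pos; auto).
assert (HC1 : 0 <= C1).
{ apply Rmult_le_pos; auto. apply Rplus_le_le_0_compat; auto. apply Rdiv_le_0_compat; [|lra].
  generalize (Rpower_pos M al). nra. }
assert (HC2 : 0 <= C2).
{ apply Rdiv_le_0_compat; [|lra]. apply Rplus_le_le_0_compat; auto.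
  apply Rmult_le_pos; auto. apply Rdiv_le_0_compat; [|lra]. now apply Rmult_le_pos. }
assert (HC3 : 0 <= C3) by (apply Rdiv_le_0_compat; lra).
exists (C1 + C2 + C3). split; [lra|].
intros eta a b HA L HL HLe.
assert (Heta := amp_eta _ _ _ _ _ _ HA).
assert (HD := wkb_energy _ _ _ _ _ _ _ _ _ _ _ _ HP HA). fold D in HD.
set (y := L * eta). assert (Hy : 0 < y < x1) by (unfold y; split; [nra|auto]).
assert (N := wkb_near_origin _ _ _ _ _ _ _ _ _ _ _ _ D HP HA HD y Hy).
assert (F := wkb_left_mover_bound _ _ _ _ _ _ _ _ _ _ _ _ D HP HA HD y ltac:(lra)).
fold C1 in F. fold C2 C3 in N.
replace (/ eta * y) with L in N by (unfold y; field; lra).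
set (e := Rpower eta al) in *. assert (He : 0 < e) by apply Rpower_pos.
set (X := (RtoC (/ 4 * e) * rot_int (/ al) (PI / 2) (Rpower L al))%C) in *.
assert (Pm : forall c, Rpower y c = Rpower L c * Rpower eta c).
{ intros c. unfold y. symmetry. now apply Rpower_mult_distr. }
assert (E1 : eta * Rpower y (al - 1) = e * Rpower L (al - 1)).
{ rewrite Pm. transitivity (Rpower L (al - 1) * (eta * Rpower eta (al - 1))); [ring|].
  rewrite mult_Rpower_pred by auto. fold e. ring. }
assert (E2 : Rpower y (2 * al) = e * (Rpower L (2 * al) * e)).
{ rewrite Pm. replace (2 * al) with (al + al) at 2 by ring. rewrite (Rpower_plus al al eta). fold e. ring. }
assert (E3 : / eta * Rpower y (2 * al + 1) = e * (Rpower L (2 * al + 1) * e)).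
{ rewrite Pm. replace (2 * al + 1) with (al + al + 1) at 2 by ring.
  rewrite !(Rpower_plus _ _ eta), (Rpower_1 eta) by auto. fold e. field. lra. }
replace (b 0%R - X)%C with (b y - (b y + X - b 0%R))%C by ring.
eapply Rle_trans; [apply Cmod_triangle|]. rewrite Cmod_opp.
rewrite E1 in F.
replace (/ eta * C3 * Rpower y (2 * al + 1)) with (C3 * (/ eta * Rpower y (2 * al + 1))) in N by ring.
rewrite E2, E3 in N.
eapply Rle_trans; [apply Rplus_le_compat; [apply F|apply N]|].
assert (P1 := Rpower_pos L (al - 1)). assert (P2 := Rpower_pos L (2 * al)).
assert (P3 := Rpower_pos L (2 * al + 1)).
replace (C1 * (e * Rpower L (al - 1)) + (C2 * (e * (Rpower L (2 * al) * e)) + C3 * (e * (Rpower L (2 * al + 1) * e))))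
  with (e * (C1 * Rpower L (al - 1) + C2 * (Rpower L (2 * al) * e) + C3 * (Rpower L (2 * al + 1) * e))) by ring.
apply Rmult_le_compat_l; [lra|].
set (A1 := Rpower L (al - 1)) in *. set (A2 := Rpower L (2 * al)) in *. set (A3 := Rpower L (2 * al + 1)) in *.
assert (Q2 : 0 < A2 * e) by now apply Rmult_lt_0_compat.
assert (Q3 : 0 < A3 * e) by now apply Rmult_lt_0_compat.
rewrite (Rmult_plus_distr_r A2). set (q2 := A2 * e) in *. set (q3 := A3 * e) in *. nra.
Qed.

(** * WKB amplitudes of the scattering solution *)

(** Powers are bounded above and below away from 0, so there a singular bound follows from
    compactness. *)
Lemma power_bound_on_segment (f : R -> R) (s M c : R) :
  0 < s <= M -> (forall x, s <= x <= M -> continuous f x) ->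
  exists K, 0 <= K /\ forall x, s <= x <= M -> Rabs (f x) <= K * Rpower x c.
Proof.
intros Hs Cf.
destruct (continuity_ab_maj (fun x => Rabs (f x * Rpower x (- c))) s M) as [y [Hy _]]; [lra| |].
- intros x Hx. apply continuity_pt_continuous.
  apply (continuous_comp (fun x => f x * Rpower x (- c)) Rabs).
  + apply continuous_Rmult; auto. eapply derive_continuous, derive_Rpower; lra.
  + apply continuity_pt_continuous, Rcontinuity_abs.
- exists (Rabs (f y * Rpower y (- c))). split; [apply Rabs_pos|]. intros x Hx.
  specialize (Hy x Hx). rewrite Rabs_mult, (Rabs_pos_eq (Rpower x _)) in Hy by (left; apply Rpower_pos).
  replace (Rabs (f x)) with (Rabs (f x) * Rpower x (- c) * Rpower x c).
  + apply Rmult_le_compat_r; [left; apply Rpower_pos|exact Hy].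
  + rewrite Rmult_assoc, <- Rpower_plus, Rplus_opp_l, Rpower_O by lra. ring.
Qed.

Lemma sup_fun_gap V : Rbar_lt (sup_fun V) 1 -> exists d, 0 < d /\ forall x, d <= 1 - V x.
Proof.
intros H. destruct (Lub_Rbar_correct (fun y => exists x, y = V x)) as [Hub _].
fold (sup_fun V) in Hub.
destruct (sup_fun V) as [s| |]; simpl in H; try contradiction.
- exists (1 - s). split; [lra|]. intros x. specialize (Hub (V x) (ex_intro _ x eq_refl)). simpl in Hub. lra.
- specialize (Hub (V 0) (ex_intro _ 0 eq_refl)). contradiction.
Qed.

Definition momentum (V : R -> R) (x : R) : R := sqrt (1 - V x).
Definition phase (V : R -> R) (x : R) : R := RInt (momentum V) 0 x.
(** From p^2 = 1 - V one has p' = - V' / (2 p), so this is g = p' / (2 p). The next two definitions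
    are g / p and its derivative for x > 0. *)
Definition coupling (V : R -> R) (x : R) : R := - / 4 * Derive V x / momentum V x ^ 2.
Definition coupling_ratio (V : R -> R) (x : R) : R := - / 4 * Derive V x / momentum V x ^ 3.
Definition coupling_ratio1 (V : R -> R) (x : R) : R :=
  - / 4 * Derive (Derive V) x / momentum V x ^ 3 - 3 / 8 * Derive V x ^ 2 / momentum V x ^ 5.

Lemma momentum_pos V d : 0 < d -> (forall x, d <= 1 - V x) -> forall x, 0 < momentum V x.
Proof. intros Hd H x. apply sqrt_lt_R0. specialize (H x). lra. Qed.

Lemma momentum_sq V d : 0 < d -> (forall x, d <= 1 - V x) -> forall x, momentum V x ^ 2 = 1 - V x.
Proof. intros Hd H x. apply pow2_sqrt. specialize (H x). lra. Qed.

Lemma derive_sqrt (f : R -> R) (x l : R) :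
  is_derive f x l -> 0 < f x -> is_derive (fun y => sqrt (f y)) x (l / (2 * sqrt (f x))).
Proof.
intros H Hp. eapply derive_eq. apply (derive_comp sqrt f).
apply is_derive_Reals, derivable_pt_lim_sqrt, Hp. exact H. reflexivity.
Qed.

Lemma derive_momentum V d x l :
  0 < d -> (forall x, d <= 1 - V x) -> is_derive V x l ->
  is_derive (momentum V) x (- l / (2 * momentum V x)).
Proof.
intros Hd H Hl. eapply derive_eq. apply (derive_sqrt (fun y => 1 - V y)).
apply derive_minus. apply derive_const. exact Hl. specialize (H x). lra.
unfold momentum. unfold Rdiv. ring.
Qed.

Lemma continuous_sqrt_comp (f : R -> R) x : continuous f x -> continuous (fun y => sqrt (f y)) x.
Proof. intros H. apply (continuous_comp f sqrt); auto. apply continuous_sqrt. Qed.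

Lemma potential_wkb_profile alpha V x0 M d :
  0 < alpha < 1 -> 0 < x0 < 1 -> 1 <= M -> 0 < d ->
  (forall x, x < x0 -> V x = pos_part_pow alpha x) ->
  smooth_away_from_0 V -> (forall x, continuous V x) -> (forall x, d <= 1 - V x) ->
  Derive V M = 0 ->
  exists K, wkb_profile alpha M x0 K (momentum V) (phase V) (coupling V) (coupling_ratio V) (coupling_ratio1 V).
Proof.
intros Hal Hx0 HM Hd HV HS CV HdV HVM.
assert (D1 : forall x, 0 < x -> is_derive V x (Derive V x)).
{ intros x Hx. apply Derive_correct. apply (HS 1%nat x). lra. }
assert (D2 : forall x, 0 < x -> is_derive (Derive V) x (Derive (Derive V) x)).
{ intros x Hx. apply Derive_correct. apply (HS 2%nat x). lra. }
assert (C2 : forall x, 0 < x -> continuous (Derive (Derive V)) x).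
{ intros x Hx. eapply derive_continuous, Derive_correct. apply (HS 3%nat x). lra. }
assert (E1 : forall x, 0 < x < x0 -> Derive V x = alpha * Rpower x (alpha - 1)).
{ intros x Hx. apply is_derive_unique.
  apply (derive_ext_eventually (pos_part_pow alpha) V x _ (x0 - x)); [lra| |].
  - intros y Hy. apply Rabs_def2 in Hy. symmetry. apply HV. lra.
  - apply derive_pos_part_pow; lra. }
assert (E2 : forall x, 0 < x < x0 -> Derive (Derive V) x = alpha * ((alpha - 1) * Rpower x (alpha - 1 - 1))).
{ intros x Hx. apply is_derive_unique.
  assert (Hm : 0 < Rmin x (x0 - x)) by (apply Rmin_pos; lra).
  apply (derive_ext_eventually (fun x => alpha * Rpower x (alpha - 1)) (Derive V) x _ _ Hm).
  - intros y Hy. apply Rabs_def2 in Hy. symmetry. apply E1.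
    generalize (Rmin_l x (x0 - x)) (Rmin_r x (x0 - x)). lra.
  - apply derive_scale, derive_Rpower; lra. }
(* Starting at [x0 / 2] makes this range overlap with (0, x0), where V' and V'' are explicit
   powers. *)
destruct (power_bound_on_segment (Derive V) (x0 / 2) M (alpha - 1)) as [K1 [HK1 B1]].
{ lra. } { intros x Hx. eapply derive_continuous, D2. lra. }
destruct (power_bound_on_segment (Derive (Derive V)) (x0 / 2) M (alpha - 1 - 1)) as [K2 [HK2 B2]].
{ lra. } { intros x Hx. apply C2. lra. }
assert (F1 : forall x, 0 < x <= M -> Rabs (Derive V x) <= (K1 + 1) * Rpower x (alpha - 1)).
{ intros x Hx. assert (Hr := Rpower_pos x (alpha - 1)). destruct (Rlt_dec x x0).
  - rewrite E1, Rabs_mult, !Rabs_pos_eq by lra. nra.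
  - specialize (B1 x). nra. }
assert (F2 : forall x, 0 < x <= M -> Rabs (Derive (Derive V) x) <= (K2 + 1) * Rpower x (alpha - 1 - 1)).
{ intros x Hx. assert (Hr := Rpower_pos x (alpha - 1 - 1)). destruct (Rlt_dec x x0).
  - rewrite E2, <- Rmult_assoc, Rabs_mult, (Rabs_pos_eq (Rpower _ _)) by lra.
    apply Rmult_le_compat_r; [lra|]. apply Rabs_le. nra.
  - specialize (B2 x). nra. }
assert (Hp := momentum_pos V d Hd HdV). assert (Hp2 := momentum_sq V d Hd HdV).
set (i := / sqrt d).
assert (Hsd : 0 < sqrt d) by now apply sqrt_lt_R0.
assert (Hi : 0 < i) by now apply Rinv_0_lt_compat.
assert (Hip : forall x, 0 < / momentum V x <= i).
{ intros x. split; [now apply Rinv_0_lt_compat|]. apply Rinv_le_contravar; auto.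
  apply sqrt_le_1_alt, HdV. }
assert (Hipn : forall n x, 0 < / momentum V x ^ n <= i ^ n).
{ intros n x. rewrite <- pow_inv. destruct (Hip x). split; [now apply pow_lt|].
  apply pow_incr. lra. }
assert (Cp : forall x, continuous (momentum V) x).
{ intros x. apply continuous_sqrt_comp. apply continuous_Rminus; auto. apply continuous_const. }
assert (Dphi : forall x, is_derive (phase V) x (momentum V x)).
{ intros x. now apply derive_RInt_upper. }
set (Kg := (K1 + 1) * i ^ 2). set (Kk := (K1 + 1) * i ^ 3).
set (Kk1 := (K2 + 1) * i ^ 3 + (K1 + 1) ^ 2 * Rpower M alpha * i ^ 5).
assert (Pi : forall n, 0 < i ^ n) by (intros; now apply pow_lt).
assert (HKg : 0 <= Kg) by (apply Rmult_le_pos; [lra|left; apply Pi]).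
assert (HKk : 0 <= Kk) by (apply Rmult_le_pos; [lra|left; apply Pi]).
assert (HKk1 : 0 <= Kk1).
{ apply Rplus_le_le_0_compat; apply Rmult_le_pos; try (left; apply Pi); [lra|].
  apply Rmult_le_pos; [apply pow2_ge_0|left; apply Rpower_pos]. }
assert (Hi2 := Pi 2%nat).
(* One constant for all fields: [i ^ 2] serves the singular part of g, and 1 serves the phase. *)
exists (Kg + Kk + Kk1 + i ^ 2 + 1).
constructor; try lra.
- intros x. eapply derive_continuous, Dphi.
- intros x _. apply Dphi.
- intros x Hx. eapply derive_eq.
  + assert (Dm := derive_momentum V d x _ Hd HdV (D1 x Hx)).
    apply (derive_mult (fun x => - / 4 * Derive V x) (fun x => / momentum V x ^ 3)).
    * apply derive_scale, D2, Hx.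
    * apply (is_derive_inv (fun x => momentum V x ^ 3)).
      { apply (is_derive_pow (momentum V) 3 x _ Dm). }
      apply pow_nonzero. specialize (Hp x). lra.
  + specialize (Hp x). unfold coupling_ratio1. simpl. field. lra.
- intros x Hx. unfold coupling, coupling_ratio. specialize (Hp x). field. lra.
- unfold coupling_ratio. rewrite HVM. unfold Rdiv. ring.
- intros x Hx. unfold coupling, Rdiv. rewrite !Rabs_mult, Rabs_Ropp, (Rabs_pos_eq (/ 4)) by lra.
  destruct (Hipn 2%nat x) as [I1 I2]. rewrite (Rabs_pos_eq (/ _ ^ 2)) by lra.
  assert (Hr := Rpower_pos x (alpha - 1)). specialize (F1 x Hx).
  assert (T : Rabs (Derive V x) * / momentum V x ^ 2 <= (K1 + 1) * Rpower x (alpha - 1) * i ^ 2)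
    by (apply Rmult_le_compat; auto; [apply Rabs_pos|lra]).
  assert (T0 : 0 <= Rabs (Derive V x) * / momentum V x ^ 2) by (apply Rmult_le_pos; [apply Rabs_pos|lra]).
  apply Rle_trans with (Kg * Rpower x (alpha - 1)); [unfold Kg; lra|].
  apply Rmult_le_compat_r; lra.
- intros x Hx. unfold coupling_ratio, Rdiv. rewrite !Rabs_mult, Rabs_Ropp, (Rabs_pos_eq (/ 4)) by lra.
  destruct (Hipn 3%nat x) as [I1 I2]. rewrite (Rabs_pos_eq (/ _ ^ 3)) by lra.
  assert (Hr := Rpower_pos x (alpha - 1)). specialize (F1 x Hx).
  assert (T : Rabs (Derive V x) * / momentum V x ^ 3 <= (K1 + 1) * Rpower x (alpha - 1) * i ^ 3)
    by (apply Rmult_le_compat; auto; [apply Rabs_pos|lra]).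
  assert (T0 : 0 <= Rabs (Derive V x) * / momentum V x ^ 3) by (apply Rmult_le_pos; [apply Rabs_pos|lra]).
  apply Rle_trans with (Kk * Rpower x (alpha - 1)); [unfold Kk; lra|].
  apply Rmult_le_compat_r; lra.
- intros x Hx. unfold coupling_ratio1, Rdiv.
  destruct (Hipn 3%nat x) as [I1 I2]. destruct (Hipn 5%nat x) as [J1 J2].
  assert (Hr := Rpower_pos x (alpha - 1 - 1)). specialize (F1 x Hx). specialize (F2 x Hx).
  assert (T : Rabs (Derive (Derive V) x * / momentum V x ^ 3) <= (K2 + 1) * Rpower x (alpha - 1 - 1) * i ^ 3).
  { rewrite Rabs_mult, (Rabs_pos_eq (/ _ ^ 3)) by lra.
    apply Rmult_le_compat; auto; [apply Rabs_pos|lra]. }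
  assert (Hsq : Derive V x ^ 2 <= (K1 + 1) ^ 2 * Rpower M alpha * Rpower x (alpha - 1 - 1)).
  { rewrite <- pow2_abs.
    apply Rle_trans with (((K1 + 1) * Rpower x (alpha - 1)) ^ 2); [apply pow_incr; split; auto; apply Rabs_pos|].
    rewrite Rpow_mult_distr, Rmult_assoc. apply Rmult_le_compat_l; [apply pow2_ge_0|].
    simpl. rewrite Rmult_1_r, <- Rpower_plus.
    replace (alpha - 1 + (alpha - 1)) with (alpha + (alpha - 1 - 1)) by ring. rewrite Rpower_plus.
    apply Rmult_le_compat_r; [lra|]. apply Rle_Rpower_l; lra. }
  assert (S : 0 <= Derive V x ^ 2 * / momentum V x ^ 5 <= (K1 + 1) ^ 2 * Rpower M alpha * Rpower x (alpha - 1 - 1) * i ^ 5).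
  { split; [apply Rmult_le_pos; [apply pow2_ge_0|lra]|].
    apply Rmult_le_compat; auto; [apply pow2_ge_0|lra]. }
  apply Rle_trans with (Kk1 * Rpower x (alpha - 1 - 1)).
  + apply Rabs_le_between in T. unfold Kk1. apply Rabs_le. lra.
  + apply Rmult_le_compat_r; lra.
(* Here 1 / p^2 - 1 = x^alpha / (1 - x^alpha), so replacing p by 1 in g costs one more factor
   x^alpha. *)
- intros x Hx. unfold coupling. rewrite Hp2, HV, pos_part_pow_pos, E1 by lra.
  assert (HVx := HdV x). rewrite HV, pos_part_pow_pos in HVx by lra.
  replace (- / 4 * (alpha * Rpower x (alpha - 1)) / (1 - Rpower x alpha) + / 4 * alpha * Rpower x (alpha - 1))
    with (- (/ 4 * alpha * (Rpower x (alpha - 1) * Rpower x alpha) * / (1 - Rpower x alpha))) by (field; lra).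
  rewrite <- Rpower_plus. replace (alpha - 1 + alpha) with (2 * alpha - 1) by ring.
  assert (Hr := Rpower_pos x (2 * alpha - 1)).
  destruct (Hipn 2%nat x) as [I1 I2]. rewrite Hp2, HV, pos_part_pow_pos in I1, I2 by lra.
  rewrite Rabs_Ropp, Rabs_pos_eq.
  + apply Rle_trans with (/ 4 * alpha * Rpower x (2 * alpha - 1) * i ^ 2).
    * apply Rmult_le_compat_l; [|lra]. apply Rmult_le_pos; lra.
    * assert (0 <= Rpower x (2 * alpha - 1) * i ^ 2) by (apply Rmult_le_pos; lra).
      assert (0 <= (Kg + Kk + Kk1 + 1) * Rpower x (2 * alpha - 1)) by (apply Rmult_le_pos; lra).
      nra.
  + apply Rmult_le_pos; [|lra]. apply Rmult_le_pos; lra.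
- intros x Hx. apply Rle_trans with (1 * Rpower x (1 + alpha)).
  2:{ apply Rmult_le_compat_r; [left; apply Rpower_pos|lra]. }
  rewrite <- Cmod_R.
  set (P := fun y => phase V y - y).
  assert (P0 : P 0 = 0) by (unfold P, phase; rewrite RInt_same; ring).
  replace (RtoC (phase V x - x)) with (RtoC (P x) - RtoC (P 0))%C by (rewrite P0; unfold P; ring).
  apply Rle_trans with (/ (1 + alpha) * pos_part_pow (1 + alpha) x - / (1 + alpha) * pos_part_pow (1 + alpha) 0).
  + apply (Cmean_value (fun y => RtoC (P y)) (fun y => RtoC (momentum V y - 1))
      (fun y => / (1 + alpha) * pos_part_pow (1 + alpha) y)
      (fun y => / (1 + alpha) * ((1 + alpha) * Rpower y (1 + alpha - 1)))); [lra| |].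
    * intros z Hz. split.
      -- apply Ccontinuous_RtoC, continuous_Rminus; [eapply derive_continuous, Dphi|apply continuous_id].
      -- apply continuous_Rmult; [apply continuous_const|apply continuous_pos_part_pow; lra].
    * intros z Hz. refine (conj _ (conj (derive_scale _ _ _ _ (derive_pos_part_pow _ z (proj1 Hz))) _)).
      -- apply Cderive_RtoC, derive_minus; [apply Dphi|apply derive_id].
      -- rewrite Cmod_R.
         replace (/ (1 + alpha) * ((1 + alpha) * Rpower z (1 + alpha - 1))) with (Rpower z alpha)
           by (replace (1 + alpha - 1) with alpha by ring; field; lra).
         specialize (Hp2 z). specialize (Hp z). rewrite HV, pos_part_pow_pos in Hp2 by lra.
         assert (Hr := Rpower_pos z alpha).
         (* (1 - p) (1 + p) = z^alpha with p > 0, hence |p - 1| <= z^alpha. *)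
         apply Rabs_le. nra.
  + rewrite (pos_part_pow_npos _ 0), pos_part_pow_pos by lra.
    assert (Hr := Rpower_pos x (1 + alpha)).
    assert (/ (1 + alpha) <= 1) by (rewrite <- Rinv_1 at 2; apply Rinv_le_contravar; lra). nra.
Qed.

Lemma continuous_phase V d : 0 < d -> (forall x, continuous V x) ->
  forall x, continuous (momentum V) x /\ is_derive (phase V) x (momentum V x).
Proof.
intros Hd CV.
assert (Cp : forall x, continuous (momentum V) x).
{ intros y. apply continuous_sqrt_comp. apply continuous_Rminus; auto. apply continuous_const. }
intros x. split; auto. now apply derive_RInt_upper.
Qed.

(* The amplitude [a] is the mode with [s = -1], and [b] the one with [s = 1]. *)
Definition mode (V : R -> R) (h s : R) (u u1 : R -> C) (x : R) : C :=
  (expi (s / h * phase V x) * (RtoC (/ 2 * sqrt (momentum V x)) * u x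
     + Ci * (RtoC (s * h / 2 * / sqrt (momentum V x)) * u1 x)))%C.

Lemma mode_continuous V d h s q u u1 x :
  0 < d -> (forall x, continuous V x) -> (forall x, d <= 1 - V x) -> Csolution q u u1 ->
  Ccontinuous (mode V h s u u1) x.
Proof.
intros Hd CV HdV Hs.
destruct (continuous_phase V d Hd CV x) as [Cp Dp].
destruct (Csolution_continuous q u u1 x Hs) as [Cu Cu1].
assert (Cm : continuous (fun y => sqrt (momentum V y)) x) by now apply continuous_sqrt_comp.
apply Ccontinuous_mult.
- apply (Ccontinuous_expi (fun y => s / h * phase V y)).
  apply continuous_Rmult; [apply continuous_const|eapply derive_continuous, Dp].
- apply Ccontinuous_plus; [|apply Ccontinuous_mult; [apply Ccontinuous_const|]];
    apply Ccontinuous_mult; auto; apply Ccontinuous_RtoC;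
    apply continuous_Rmult; auto; try apply continuous_const.
  apply (continuous_comp (fun y => sqrt (momentum V y)) Rinv); auto.
  apply continuous_Rinv. apply Rgt_not_eq, sqrt_lt_R0. now apply (momentum_pos V d).
Qed.

(** Since g is the logarithmic derivative of p^{1/2}, differentiating the weights p^{1/2} and
    p^{-1/2} multiplies the u term by g and the u' term by - g, which exchanges the two modes. All
    other terms, from the phase, u' and u'', cancel because s^2 = 1. *)
Lemma mode_derive V d h s u u1 x :
  0 < h -> s * s = 1 ->
  0 < d -> (forall x, continuous V x) -> (forall x, d <= 1 - V x) -> is_derive V x (Derive V x) ->
  Csolution (fun x => (V x - 1) / h ^ 2) u u1 ->
  Cderive (mode V h s u u1) x
    (RtoC (coupling V x) * (expi (s / h * phase V x) * expi (s / h * phase V x)) * mode V h (- s) u u1 x)%C.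
Proof.
intros Hh Hss Hd CV HdV DV Hs.
destruct (continuous_phase V d Hd CV x) as [Cp Dp].
destruct (Hs x) as [Du Du1].
assert (Hp := momentum_pos V d Hd HdV x). assert (Hp2 := momentum_sq V d Hd HdV x).
assert (Dm := derive_sqrt _ _ _ (derive_momentum V d x _ Hd HdV DV) Hp).
set (m := sqrt (momentum V x)) in *.
assert (Hm : 0 < m) by now apply sqrt_lt_R0.
assert (Hmm : momentum V x = m ^ 2) by (unfold m; rewrite pow2_sqrt; lra).
set (c := coupling V x).
assert (Hc : - Derive V x / (2 * momentum V x) / (2 * m) = c * m).
{ unfold c, coupling. rewrite Hmm. field. lra. }
rewrite Hc in Dm.
assert (Dim : is_derive (fun y => / sqrt (momentum V y)) x (- c / m)).
{ eapply derive_eq. apply (is_derive_inv (fun y => sqrt (momentum V y))); [exact Dm|].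
  fold m. lra. fold m. field. lra. }
assert (HV : V x - 1 = - m ^ 4) by (replace (m ^ 4) with ((m ^ 2) ^ 2) by ring; rewrite <- Hmm; lra).
unfold mode. eapply Cderive_eq.
- apply Cderive_mult.
  + apply (Cderive_expi (fun y => s / h * phase V y)), derive_scale, Dp.
  + apply Cderive_plus; [|apply Cderive_cmul]; apply Cderive_mult; eauto;
      apply Cderive_RtoC, derive_scale; [exact Dm|exact Dim].
- cbv beta. fold m. rewrite Hmm, HV.
  replace (- s / h * phase V x) with (- (s / h * phase V x)) by (unfold Rdiv; ring).
  assert (He := expi_opp (s / h * phase V x)).
  set (e := expi (s / h * phase V x)) in *. set (e' := expi (- (s / h * phase V x))) in *.
  match goal with |- _ = (?g * _ * (_ * ?S))%C => transitivity (e * (g * S) * (e * e'))%C; [|ring] end.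
  rewrite He, Cmult_1_r.
  match goal with |- (Ci * ?T * e * ?S1 + e * ?S2)%C = _ =>
    transitivity (e * (Ci * T * S1 + S2))%C; [ring|] end.
  f_equal. rewrite (surjective_pairing (u x)), (surjective_pairing (u1 x)).
  assert (Hs2 : s ^ 2 = 1) by lra.
  apply injective_projections; simpl; apply Rminus_diag_uniq; field_simplify; try lra;
   rewrite ?Hs2; field; lra.
Qed.

(** V vanishes at 0 and at M, so p = 1 there and the modes are the plane wave coefficients up to a
    phase: b is R at 0, and it is 0 at M since nothing comes in from the right. The bound |R| <= 1
    is conservation of the current. *)
Lemma scattering_amplitudes V M d h u u1 (r t : C) :
  0 < h -> 0 < M ->
  0 < d -> (forall x, continuous V x) -> (forall x, d <= 1 - V x) ->
  (forall x, 0 < x -> is_derive V x (Derive V x)) ->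
  V 0 = 0 -> V M = 0 ->
  Csolution (fun x => (V x - 1) / h ^ 2) u u1 ->
  u 0 = plane (/ h) (RtoC 1) r 0 -> u1 0 = plane1 (/ h) (RtoC 1) r 0 ->
  u M = plane (/ h) t (RtoC 0) M -> u1 M = plane1 (/ h) t (RtoC 0) M ->
  mode V h 1 u u1 0 = r /\
  wkb_amplitudes M (h / 2) (phase V) (coupling V) (mode V h (-1) u u1) (mode V h 1 u u1).
Proof.
intros Hh HM Hd CV HdV DV HV0 HVM Hs Hu0 Hu10 HuM Hu1M.
assert (Hm0 : sqrt (momentum V 0) = 1) by (unfold momentum; rewrite HV0, Rminus_0_r, sqrt_1; apply sqrt_1).
assert (HmM : sqrt (momentum V M) = 1) by (unfold momentum; rewrite HVM, Rminus_0_r, sqrt_1; apply sqrt_1).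
assert (Hph0 : phase V 0 = 0) by apply RInt_same.
assert (Hb0 : mode V h 1 u u1 0 = r).
{ unfold mode. rewrite Hm0, Hph0, Hu0, Hu10. unfold plane, plane1. rewrite !Rmult_0_r, expi_0.
  apply injective_projections; simpl; field; lra. }
split; auto. constructor.
- lra.
- intros x. split; eapply mode_continuous; eauto.
- intros x Hx. eapply Cderive_eq. apply (mode_derive V d h (-1)); auto; lra.
  rewrite <- expi_plus. replace (- -1) with 1 by ring.
  replace (-1 / h * phase V x + -1 / h * phase V x) with (- / (h / 2) * phase V x) by (field; lra).
  reflexivity.
- intros x Hx. eapply Cderive_eq. apply (mode_derive V d h 1); auto; lra.
  rewrite <- expi_plus.
  replace (1 / h * phase V x + 1 / h * phase V x) with (/ (h / 2) * phase V x) by (field; lra).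
  reflexivity.
- unfold mode. rewrite Hm0, Hph0, Hu0, Hu10. unfold plane, plane1. rewrite !Rmult_0_r, expi_0.
  apply injective_projections; simpl; field; lra.
- rewrite Hb0.
  assert (H := wronskian_constant _ u u1 0 M Hs).
  rewrite (wronskian_plane u u1 _ 0 _ _ Hu0 Hu10), (wronskian_plane u u1 _ M _ _ HuM Hu1M) in H.
  apply Rmult_eq_reg_l in H; [|apply Rgt_not_eq; now apply Rinv_0_lt_compat].
  rewrite Cmod_1, Cmod_0 in H. assert (H0 := pow2_ge_0 (Cmod t)). assert (H1 := Cmod_ge_0 r). nra.
- unfold mode. rewrite HmM, HuM, Hu1M. unfold plane, plane1.
  match goal with |- (_ * ?S)%C = _ => enough (HS : S = RtoC 0) by (rewrite HS; ring) end.
  unfold expi. rewrite (surjective_pairing t). apply injective_projections; simpl; field; lra.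
Qed.

(** * The limit of the reflection coefficient *)

Lemma potential_continuous alpha V x0 :
  0 < alpha -> 0 < x0 -> (forall x, x < x0 -> V x = pos_part_pow alpha x) ->
  smooth_away_from_0 V -> forall x, continuous V x.
Proof.
intros Hal Hx0 HV HS x. destruct (Req_dec x 0) as [->|Hx].
- apply (continuous_eq_near (pos_part_pow alpha) V 0 x0 Hx0).
  + intros y Hy. apply Rabs_def2 in Hy. symmetry. apply HV. lra.
  + now apply continuous_pos_part_pow.
- eapply derive_continuous, Derive_correct. apply (HS 1%nat x Hx).
Qed.

Lemma filterlim_C_at_0plus (f : R -> C) (l : C) :
  (forall eps, 0 < eps -> exists d, 0 < d /\ forall h, 0 < h < d -> Cmod (f h - l)%C < eps) ->
  filterlim f (at_right 0) (locally l).
Proof.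
intros H P [eps HP]. destruct (H eps (cond_pos eps)) as [d [Hd Hf]].
exists (mkposreal d Hd). intros y Hy Hy0. apply HP.
assert (Hyd : Rabs (y - 0) < d) by apply Hy. rewrite Rminus_0_r, Rabs_pos_eq in Hyd by lra.
specialize (Hf y (conj Hy0 Hyd)).
assert (Hm := Rmax_Cmod (f y - l)%C).
split; apply Rle_lt_trans with (2 := Hf); apply Rle_trans with (2 := Hm).
- apply (Rmax_l (Rabs (fst (f y - l)%C)) (Rabs (snd (f y - l)%C))).
- apply (Rmax_r (Rabs (fst (f y - l)%C)) (Rabs (snd (f y - l)%C))).
Qed.

Theorem proposition1p1 :
  forall (alpha : R) (V : R -> R) (x0 : R),
    0 < alpha < 1 ->
    bounded_fun V ->
    compactly_supported V ->
    0 < x0 < 1 ->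
    (forall x : R, x < x0 -> V x = pos_part_pow alpha x) ->
    smooth_away_from_0 V ->
    Rbar_lt (sup_fun V) 1 ->
    (forall h : R, 0 < h ->
       exists! u : R -> C, exists r t : C, scattering_solution V h u r t) /\
    (forall (u : R -> R -> C) (r t : R -> C),
       (forall h : R, 0 < h -> scattering_solution V h (u h) (r h) (t h)) ->
       equiv_at_0plus r
         (fun h : R =>
            (RtoC (Rpower 2 (- alpha - 2)) * expi (alpha * PI / 2)
             * RtoC (Gamma (alpha + 1)) * RtoC (Rpower h alpha))%C)).
Proof.
intros alpha V x0 Hal [B HB] [M0 HM0] Hx0 HV HS Hsup.
assert (CV := potential_continuous alpha V x0 ltac:(lra) ltac:(lra) HV HS).
assert (HV0 : forall x, x <= 0 -> V x = 0).
{ intros x Hx. rewrite HV by lra. apply pos_part_pow_npos, Hx. }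
split.
{ intros h Hh. now apply (scattering_exists_unique V M0 B h). }
intros u r t Hsc.
destruct (sup_fun_gap V Hsup) as [d [Hd HdV]].
(* Strictly beyond the support bound, so that V vanishes around [M] and V'(M) = 0; this is the
   vanishing of k at the right end. *)
set (M := Rmax 1 M0 + 1).
assert (HM1 : 1 <= M) by (unfold M; generalize (Rmax_l 1 M0); lra).
assert (HM2 : M0 < M) by (unfold M; generalize (Rmax_r 1 M0); lra).
assert (HVM : forall x, M0 < x -> 0 <= x -> V x = 0).
{ intros x Hx Hx'. apply HM0. now rewrite Rabs_pos_eq. }
assert (D1 : forall x, 0 < x -> is_derive V x (Derive V x)).
{ intros x Hx. apply Derive_correct. apply (HS 1%nat x). lra. }
assert (HdVM : Derive V M = 0).
{ apply is_derive_unique.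
  assert (Hm : 0 < Rmin 1 (M - M0)) by (apply Rmin_pos; lra).
  apply (derive_ext_eventually (fun _ => 0) V M 0 _ Hm); [|apply derive_const].
  intros y Hy. apply Rabs_def2 in Hy. generalize (Rmin_l 1 (M - M0)) (Rmin_r 1 (M - M0)). intros.
  symmetry. apply HVM; lra. }
destruct (potential_wkb_profile alpha V x0 M d Hal Hx0 HM1 Hd HV HS CV HdV HdVM) as [K HP].
destruct (wkb_reflection _ _ _ _ _ _ _ _ _ HP) as [A [HA HR]].
destruct (oscillatory_Gamma_integral alpha Hal) as [HG Hosc].
set (G := Gamma (alpha + 1)) in *.
set (Z := (expi (alpha * PI / 2) * RtoC G)%C) in *.
assert (HZ : Cmod Z = G) by (unfold Z; rewrite Cmod_mult, Cmod_expi, Cmod_R, Rmult_1_l; apply Rabs_pos_eq; lra).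
apply filterlim_C_at_0plus. intros eps Heps.
(* [e1 * eta^alpha], with [eta = h / 2], is a quarter of [eps] times the modulus of the claimed leading term. *)
set (e1 := / 4 * G * (eps / 4)).
assert (He1 : 0 < e1) by (unfold e1; nra).
assert (He1A : 0 < e1 / (A + 1)) by (apply Rdiv_lt_0_compat; lra).
destruct (Hosc e1 He1) as [L1 [HL1 H1]].
destruct (Rpower_small_at_infinity (alpha - 1) _ ltac:(lra) He1A) as [L2 [HL2 H2]].
(* The oscillatory integral is evaluated at L^alpha, so L^alpha >= [L1] makes it close to its limit;
   L >= [L2] makes the far error small. *)
set (L := Rmax (Rpower L1 (/ alpha)) L2).
assert (HLL2 : L2 <= L) by apply Rmax_r. assert (HL0 : 0 < L) by lra.
assert (HLL1 : L1 <= Rpower L alpha).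
{ rewrite <- (Rpower_1 L1) by auto. replace 1 with (/ alpha * alpha) by (field; lra).
  rewrite <- Rpower_mult. apply Rle_Rpower_l; [lra|]. split; [apply Rpower_pos|apply Rmax_l]. }
specialize (H1 _ HLL1). specialize (H2 _ HLL2).
set (S := Rpower L (2 * alpha) + Rpower L (2 * alpha + 1)).
assert (HS0 : 0 < S) by (apply Rplus_lt_0_compat; apply Rpower_pos).
assert (He1S : 0 < e1 / ((A + 1) * S)) by (apply Rdiv_lt_0_compat; nra).
(* With [L] fixed, a small h makes the near error small as well, although its constant [S] grows
   with [L]. The bound [x0 / L] below keeps the matching point in the interval where V is the exact
   power. *)
destruct (Rpower_small_at_0 alpha _ ltac:(lra) He1S) as [e3 [He3 H3]].
assert (Hx0L : 0 < x0 / L) by (apply Rdiv_lt_0_compat; lra).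
exists (Rmin e3 (x0 / L)). split; [now apply Rmin_pos|]. intros h [Hh Hhd].
assert (Hh3 : h < e3) by (eapply Rlt_le_trans; [apply Hhd|apply Rmin_l]).
assert (HhL : L * h < x0).
{ assert (h < x0 / L) by (eapply Rlt_le_trans; [apply Hhd|apply Rmin_r]).
  replace x0 with (L * (x0 / L)) by (field; lra). now apply Rmult_lt_compat_l. }
destruct (scattering_solution_data V M0 h (u h) (r h) (t h) Hh HM0 (Hsc h Hh)) as [u1 [Sol [[U0 U10] UM]]].
destruct (UM M) as [UM0 UM1]; try lra.
destruct (scattering_amplitudes V M d h (u h) u1 (r h) (t h)) as [Hr HAmp]; auto; try lra.
{ apply HV0; lra. } { apply HVM; lra. }
specialize (HR (h / 2) _ _ HAmp L HL0 ltac:(nra)). rewrite Hr in HR.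
specialize (H3 (h / 2) ltac:(lra)).
set (e := Rpower (h / 2) alpha) in *. assert (He : 0 < e) by apply Rpower_pos.
fold S in HR.
(* 2^{-alpha - 2} h^alpha = (1/4) (h / 2)^alpha. *)
assert (Hc : (RtoC (Rpower 2 (- alpha - 2)) * expi (alpha * PI / 2) * RtoC G * RtoC (Rpower h alpha))%C
   = (RtoC (/ 4 * e) * Z)%C).
{ unfold Z, e. replace (/ 4 * Rpower (h / 2) alpha) with (Rpower 2 (- alpha - 2) * Rpower h alpha).
  - rewrite RtoC_mult. ring.
  - unfold Rdiv. rewrite <- Rpower_mult_distr by lra.
    replace (Rpower (/ 2) alpha) with (Rpower 2 (- alpha)).
    + unfold Rminus. rewrite Rpower_plus. replace (Rpower 2 (- (2))) with (/ 4).
      * ring.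
      * rewrite Rpower_Ropp. f_equal. change (Rpower 2 2) with (Rpower 2 (INR 2)). rewrite Rpower_pow by lra. ring.
    + unfold Rpower. rewrite ln_Rinv by lra. f_equal. ring. }
rewrite Hc.
set (c := (RtoC (/ 4 * e) * Z)%C).
assert (Hcm : Cmod c = / 4 * e * G).
{ unfold c. rewrite Cmod_mult, HZ, Cmod_R, Rabs_pos_eq; [ring|nra]. }
assert (Hcpos : 0 < Cmod c) by (rewrite Hcm; nra).
assert (Hc0 : c <> RtoC 0) by now apply Cmod_gt_0.
replace (r h / c - RtoC 1)%C with ((r h - c) / c)%C by (field; exact Hc0).
rewrite Cmod_div by exact Hc0.
apply Rmult_lt_reg_r with (Cmod c); auto.
unfold Rdiv at 1. rewrite Rmult_assoc, Rinv_l, Rmult_1_r by lra.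
set (X := rot_int (/ alpha) (PI / 2) (Rpower L alpha)) in *.
replace (r h - c)%C with ((r h - RtoC (/ 4 * e) * X) + RtoC (/ 4 * e) * (X - Z))%C by (unfold c; ring).
eapply Rle_lt_trans; [apply Cmod_triangle|].
rewrite Cmod_mult, Cmod_R, (Rabs_pos_eq (/ 4 * e)) by nra.
assert (T1 : A * Rpower L (alpha - 1) <= e1).
{ assert (Hp := Rpower_pos L (alpha - 1)).
  replace e1 with ((A + 1) * (e1 / (A + 1))) by (field; lra).
  apply Rmult_le_compat; lra. }
assert (T2 : A * (S * e) <= e1).
{ replace e1 with ((A + 1) * (S * (e1 / ((A + 1) * S)))) by (field; lra).
  apply Rmult_le_compat; try lra; [nra|]. apply Rmult_le_compat_l; lra. }
assert (T3 : e * (A * (Rpower L (alpha - 1) + S * e)) <= e * (2 * e1)) by (apply Rmult_le_compat_l; lra).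
assert (T4 : / 4 * e * Cmod (X - Z)%C <= / 4 * e * e1) by (apply Rmult_le_compat_l; nra).
rewrite Hcm.
(* The total error is at most (2 + 1/4) [e * e1], that is 9/16 of [eps * Cmod c]. *)
assert (T5 : e * e1 = / 4 * e * G * (eps / 4)) by (unfold e1; ring).
assert (T6 : 0 < / 4 * e * G * eps) by (apply Rmult_lt_0_compat; nra).
assert (0 < e * e1) by nra. nra.
Qed.
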